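(* Let $k$ be an algebraically closed field of any characteristic and let $A$ be a retract of $B \cong k^{[n]}$ for some $n \geq 2$, with $\operatorname{tr.deg}_k A = 2$. If $A$ has a $\mathbb{Z}$-grading $A = \bigoplus_{d \in \mathbb{Z}} A_d$ with $A_0 \neq A$, then $A \cong k^{[2]}$ as $k$-algebras. Therefore, every retract of $k^{[3]}$ that has a $\mathbb{Z}$-grading $A = \bigoplus_{d \in \mathbb{Z}} A_d$ with $A_0 \neq A$ is a polynomial ring over $k$.
   Context: $k^{[n]}$ denotes the polynomial ring in $n$ variables over $k$, and $\operatorname{tr.deg}_k A$ is the transcendence degree over $k$ of the quotient field of the domain $A$. A polynomial ring over $k$ is a $k$-algebra isomorphic to $k^{[e]}$ for some $e \geq 0$. A $k$-subalgebra $A$ of a $k$-algebra $B$ is a retract of $B$ if it satisfies one of the following equivalent conditions: there is an idempotent $k$-algebra endomorphism $\varphi$ of $B$ with $\varphi(B) = A$; there is a $k$-algebra homomorphism $\varphi : B \to A$ with $\varphi|_A = \mathrm{id}_A$; there is an ideal $I$ of $B$ with $B = A \oplus I$ as $A$-modules. A $\mathbb{Z}$-grading on $A$ is a $k$-algebra grading $A = \bigoplus_{d \in \mathbb{Z}} A_d$ (each $A_d$ a $k$-subspace and $A_d A_e \subseteq A_{d+e}$), equivalently one corresponding to an action of the one-dimensional algebraic torus over $k$ on $\operatorname{Spec} A$. The grading on $A$ is not assumed to be related to any grading on $B$. *)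

(* Defs.v *)
From HB Require Import structures.
From mathcomp Require Import all_boot all_order all_algebra.
From mathcomp Require Import mpoly.

Set Implicit Arguments.
Unset Strict Implicit.
Unset Printing Implicit Defensive.

Import GRing.Theory.
Local Open Scope ring_scope.

(* The library has no join of idomainType and comAlgType; it is needed so that
   both {fraction B} and the k-algebra structure of B are available.          *)
#[short(type="idomAlgType")]
HB.structure Definition IDomAlgebra (R : nzRingType) :=
  {B of GRing.IntegralDomain B & GRing.ComUnitAlgebra R B}.

HB.instance Definition _ (n : nat) (R : idomainType) :=
  GRing.IntegralDomain.on {mpoly R[n]}.

Definition is_poly_ring (k : fieldType) (B : comAlgType k) (n : nat) : Prop :=
  exists f : {lrmorphism {mpoly k[n]} -> B}, bijective f.

(* A k-subalgebra A of B is isomorphic to k^[n] iff it is the image of an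
   injective k-algebra morphism k^[n] -> B.                                   *)
Definition sub_is_poly_ring (k : fieldType) (B : comAlgType k) (A : {pred B})
    (n : nat) : Prop :=
  exists f : {lrmorphism {mpoly k[n]} -> B},
    injective f /\ forall b : B, b \in A <-> exists p, b = f p.

(* Boolean membership in A is no restriction: b is in A iff phi b == b.       *)
Definition retract (k : fieldType) (B : comAlgType k) (A : {pred B}) : Prop :=
  GRing.subalg_closed A /\
  exists phi : {lrmorphism B -> B},
    (forall b, phi (phi b) = phi b) /\
    (forall b, b \in A <-> exists c, b = phi c).

Section TranscendenceDegree.

Variables (k K : fieldType) (iota : {rmorphism k -> K}).

Definition alg_independent (d : nat) (t : 'I_d -> K) : Prop :=
  forall p : {mpoly k[d]}, mmap iota t p = 0 -> p = 0.

(* The subfield k(t_1, ..., t_d) of K. *)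
Definition adjoined (d : nat) (t : 'I_d -> K) (x : K) : Prop :=
  exists p q : {mpoly k[d]},
    mmap iota t q != 0 /\ x = mmap iota t p / mmap iota t q.

Definition algebraic_over (E : K -> Prop) (x : K) : Prop :=
  exists P : {poly K}, [/\ P != 0, forall i, E P`_i & root P x].

(* The subfield F of K has a transcendence basis over k with d elements. *)
Definition field_trdeg (F : K -> Prop) (d : nat) : Prop :=
  exists t : 'I_d -> K,
    [/\ forall i, F (t i),
        alg_independent t
      & forall x, F x -> algebraic_over (adjoined t) x].

End TranscendenceDegree.

(* The quotient field of the subalgebra A, inside that of B. *)
Definition quotient_field (k : fieldType) (B : idomAlgType k) (A : {pred B})
    (x : {fraction B}) : Prop :=
  exists a b : B,
    [/\ a \in A, b \in A, b != 0 & x = tofrac a / tofrac b].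

Definition trdeg (k : fieldType) (B : idomAlgType k) (A : {pred B})
    (d : nat) : Prop :=
  field_trdeg (@tofrac B \o GRing.in_alg B : {rmorphism k -> {fraction B}})
    (quotient_field A) d.

(* G d is the component of degree d. The last two clauses say that every
   element of A is a sum of homogeneous elements of pairwise distinct degrees,
   and that such a sum vanishes only if all its terms do.                     *)
Definition Zgrading (k : fieldType) (B : comAlgType k) (A : {pred B})
    (G : int -> B -> Prop) : Prop :=
  [/\ forall d a, G d a -> a \in A,
      forall d, G d 0 /\
        (forall (c : k) (u v : B), G d u -> G d v -> G d (c *: u + v)),
      forall d e u v, G d u -> G e v -> G (d + e) (u * v),
      forall a, a \in A -> exists (s : seq int) (c : int -> B),
        [/\ uniq s, forall d, G d (c d) & a = \sum_(d <- s) c d]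
    & forall (s : seq int) (c : int -> B), uniq s -> (forall d, G d (c d)) ->
        \sum_(d <- s) c d = 0 -> forall d, d \in s -> c d = 0].

Definition has_nontrivial_Zgrading (k : fieldType) (B : comAlgType k)
    (A : {pred B}) : Prop :=
  exists G : int -> B -> Prop,
    Zgrading A G /\ ~ (forall a, G 0 a <-> a \in A).

(* Main.v *)
Require Import Defs.
From HB Require Import structures.
From mathcomp Require Import all_boot all_order all_algebra.
From mathcomp Require Import mpoly ring zify.
From Stdlib Require Import Classical.

(** A retract A of a polynomial ring B inherits what the proof needs from B.
    It is factorial: if a is irreducible in A and a = u p_1 ... p_m in B, then
    applying the retraction shows that a is, up to a constant, the image of some
    p_i, and this makes a prime in A ([retr_factorization]).  Units of A are
    constants, and divisibility between elements of A is the same in A as in B.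
    For a graded A, factors of homogeneous elements are homogeneous
    ([hom_factor]), so homogeneous elements are products of homogeneous primes.

    Reversing the grading if necessary, some positive degree occurs.  The proof
    then splits according to the degree zero part A_0.

    If A_0 = k, there is no negative degree: nonzero u, v of degrees d > 0 and
    -e < 0 would give a constant u^e v^d, hence a constant u.  The retraction phi
    sends X_i to c_i + m_i with c_i in k and m_i in A_+.  Taylor expansion at c
    of a = phi(a) shows that a is determined modulo the square of A_+ by a(c) and
    the linear part of a at c.  Homogeneous elements of A_+ whose linear parts at
    c form a basis of all such linear parts therefore generate A, by induction on
    the degree, and they are algebraically independent because polynomials
    vanishing at c with independent linear parts are
    ([positive_grading_polynomial]).

    If A_0 <> k, then A_0 has transcendence degree one.  Restriction to a
    suitable line embeds A_0 in k[t].  Since A is factorial, A_0 is integrally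
    closed, and Lueroth's argument gives A_0 = k[s] ([degree_zero_part]).  Suppose
    there is no negative degree.  A homogeneous prime x of positive degree divides every
    homogeneous g of positive degree, as one sees by reducing modulo x an
    algebraic relation between s, g and x; hence A = k[s, x].  Suppose both signs
    occur, and let x, y be homogeneous primes of degrees a > 0 and -b < 0.  Then
    x^b y^a lies in k[s], so some s - lam divides it and is, up to a constant, a
    monomial x^i y^j with i, j > 0.  Distinct s - lam have no common factor, so x
    and y are the only homogeneous primes of nonzero degree up to constants, and
    A = k[x, y].

    Transcendence degrees are compared by counting monomials ([trdeg_bound]); a
    consequence is that a map from k^[m] to a domain whose image contains m
    algebraically independent elements is injective ([kernel_dependent]).  This
    yields the independence of the two generators, and it handles retracts of
    k^[3]: either the retraction is injective and A is the whole ring, or any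
    three elements of A are algebraically dependent, which is all that the
    argument above uses about the transcendence degree. *)

Set Implicit Arguments.
Unset Strict Implicit.
Unset Printing Implicit Defensive.

Import Order.TTheory GRing.Theory Num.Theory.
Local Open Scope ring_scope.

(** * Divisibility and factorial domains *)

Lemma exists_minimal (T : Type) (m : T -> nat) (P : T -> Prop) :
  (exists x, P x) -> exists x, P x /\ forall y, P y -> (m x <= m y)%N.
Proof.
case=> x Px; have [j] := ubnP (m x); elim: j x Px => // j IH x Px le_xj.
have [[y [Py ltyx]]|noy] := classic (exists y, P y /\ (m y < m x)%N).
  by apply: IH Py _; apply: leq_trans ltyx _.
exists x; split=> // y Py; rewrite leqNgt; apply/negP => ltyx.
by apply: noy; exists y.
Qed.

Section Divisibility.

Variable R : idomainType.
Implicit Types (a b c p u : R) (ps : seq R).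

Definition divides a b := exists c, b = a * c.

Definition prime_elt p :=
  [/\ p != 0, p \isn't a GRing.unit
    & forall a b, divides p (a * b) -> divides p a \/ divides p b].

Definition factors_into_primes a := exists u ps,
  [/\ u \is a GRing.unit, forall p, p \in ps -> prime_elt p
    & a = u * \prod_(p <- ps) p].

Definition factorial_ring := forall a, a != 0 -> factors_into_primes a.

Lemma divides_refl a : divides a a.
Proof. by exists 1; rewrite mulr1. Qed.

Lemma divides_trans b a c : divides a b -> divides b c -> divides a c.
Proof. by move=> [x ->] [y ->]; exists (x * y); rewrite mulrA. Qed.

Lemma divides0 a : divides a 0.
Proof. by exists 0; rewrite mulr0. Qed.

Lemma dividesD a b c : divides a b -> divides a c -> divides a (b + c).
Proof. by move=> [x ->] [y ->]; exists (x + y); rewrite mulrDr. Qed.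

Lemma dividesB a b c : divides a b -> divides a c -> divides a (b - c).
Proof. by move=> [x ->] [y ->]; exists (x - y); rewrite mulrBr. Qed.

Lemma divides_mulr a b c : divides a b -> divides a (b * c).
Proof. by move=> [x ->]; exists (x * c); rewrite mulrA. Qed.

Lemma divides_mull a b c : divides a b -> divides a (c * b).
Proof. by rewrite mulrC; apply: divides_mulr. Qed.

Lemma divides_unit a u : u \is a GRing.unit -> divides a u -> a \is a GRing.unit.
Proof. by move=> uu [c def_u]; move: uu; rewrite def_u unitrM => /andP[]. Qed.

Lemma prime_divides_prod p ps : prime_elt p -> divides p (\prod_(q <- ps) q) ->
  exists2 q, q \in ps & divides p q.
Proof.
move=> [p0 pu pp]; elim: ps => [|q ps IH].
  rewrite big_nil => /(divides_unit (unitr1 R)) pu1.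
  by rewrite pu1 in pu.
rewrite big_cons => /pp[pq|/IH[r rps pr]]; first by exists q; rewrite ?mem_head.
by exists r; rewrite // inE rps orbT.
Qed.

Lemma nonunit_prime_divisor a : factorial_ring -> a != 0 ->
  a \isn't a GRing.unit -> exists2 p, prime_elt p & divides p a.
Proof.
move=> fR a0 nu; have [u [[|p ps] [uu pps def_a]]] := fR a a0.
  by move: nu; rewrite def_a big_nil mulr1 uu.
exists p; first exact/pps/mem_head.
by rewrite def_a big_cons mulrCA; exists (u * \prod_(j <- ps) j).
Qed.

(** The length of the factorization drops by one: this is the measure on which
    the extraction of contents terminates. *)
Lemma prime_cancel p a u ps : prime_elt p -> u \is a GRing.unit ->
    (forall q, q \in ps -> prime_elt q) -> p * a = u * \prod_(q <- ps) q ->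
  exists v qs, [/\ v \is a GRing.unit, forall q, q \in qs -> prime_elt q,
                   size ps = (size qs).+1 & a = v * \prod_(q <- qs) q].
Proof.
move=> pp uu pps def_a; have [p0 pu ppr] := pp.
have : divides p (u * \prod_(q <- ps) q) by rewrite -def_a; exists a.
case/ppr=> [/(divides_unit uu) pu1|]; first by rewrite pu1 in pu.
case/(prime_divides_prod pp)=> q qps [c def_q].
have [q0 qu qpr] := pps q qps.
(* q is prime and q = p * c, so q divides p or c; either way one of the two
   is a unit, and p is not *)
have uc : c \is a GRing.unit.
  have : divides q (p * c) by rewrite -def_q; apply: divides_refl.
  case/qpr=> [[d def_p]|[d def_c]].
    by apply/unitrPr; exists d; apply: (mulfI p0); rewrite mulrA -def_q mulr1.
  case/negP: pu; apply/unitrPr; exists d; apply: (mulfI q0).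
  by rewrite mulrCA -def_c mulr1.
exists (u * c), (rem q ps); split.
- by rewrite unitrM uu.
- by move=> r /mem_rem; apply: pps.
- by rewrite size_rem //; case: ps qps {pps def_a}.
apply: (mulfI p0); rewrite def_a (perm_big _ (perm_to_rem qps)) big_cons /= def_q.
ring.
Qed.

End Divisibility.

(** * Gauss: polynomial rings over factorial rings are factorial *)

Section PolynomialsOverFactorialRing.

Variable R : idomainType.
Implicit Types (p r : R) (F G H : {poly R}).

Lemma divides_polyC p F :
  divides p%:P F <-> forall i, divides p F`_i.
Proof.
split=> [[G ->] i|]; first by rewrite coefCM; exists G`_i.
elim/poly_ind: F => [_|F c IH pF]; first exact: divides0.
apply: dividesD.
  apply/divides_mulr/IH => i.
  by have := pF i.+1; rewrite coefD coefMX coefC /= addr0.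
have [d] := pF 0; rewrite coefD coefMX coefC eqxx /= add0r => ->.
by exists d%:P; rewrite polyCM.
Qed.

Lemma divides_polyC_mulX p F : divides p%:P (F * 'X) -> divides p%:P F.
Proof.
by move/divides_polyC=> pF; apply/divides_polyC=> i; have := pF i.+1; rewrite coefMX.
Qed.

(** If p divides neither F nor G, strip from both the low coefficients that p
    divides; the product of the first remaining ones is then, modulo p,
    the lowest coefficient of F * G. *)
Lemma prime_polyC p : prime_elt p -> prime_elt p%:P.
Proof.
move=> [p0 pu pp]; split; first by rewrite polyC_eq0.
  by rewrite poly_unitE coefC eqxx (negbTE pu) andbF.
move=> F; elim/poly_ind: F => [|F c IHF] G; first by left; apply: divides0.
elim/poly_ind: G => [|G d IHG] pFG; first by right; apply: divides0.
have [pc|npc] := classic (divides p%:P c%:P).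
  have/IHF[pF|] : divides p%:P (F * (G * 'X + d%:P)); [|by left; apply: dividesD (divides_mulr _ pF) pc|by right].
  apply: divides_polyC_mulX; rewrite mulrAC.
  have -> : F * 'X * (G * 'X + d%:P) =
     (F * 'X + c%:P) * (G * 'X + d%:P) - c%:P * (G * 'X + d%:P) by ring.
  exact/(dividesB pFG)/divides_mulr.
have [pd|npd] := classic (divides p%:P d%:P).
  have/IHG[|pG] : divides p%:P ((F * 'X + c%:P) * G); [|by left|by right; apply: dividesD (divides_mulr _ pG) pd].
  apply: divides_polyC_mulX.
  have -> : (F * 'X + c%:P) * G * 'X =
     (F * 'X + c%:P) * (G * 'X + d%:P) - (F * 'X + c%:P) * d%:P by ring.
  exact/(dividesB pFG)/divides_mull.
have/divides_polyC/(_ 0) := pFG.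
rewrite coef0M !coefD !coefMX !coefC !eqxx !add0r => /pp[[e def_c]|[e def_d]].
  by case: npc; exists e%:P; rewrite def_c polyCM.
by case: npd; exists e%:P; rewrite def_d polyCM.
Qed.

Hypothesis fR : factorial_ring R.

(** A scalar factor of a product can be distributed over the two factors, one
    prime at a time. *)
Lemma gauss_split r F G H : r != 0 -> r%:P * F = G * H ->
  exists r1 r2 G1 H1, [/\ G = r1%:P * G1, H = r2%:P * H1 & F = G1 * H1].
Proof.
move=> /fR[u [ps [uu pps ->]]] {r}.
elim: ps pps G H => [|p ps IH] pps G H.
  rewrite big_nil mulr1 => def_GH.
  exists 1, u, G, (u^-1%:P * H); split; first by rewrite mul1r.
    by rewrite mulrA -polyCM divrr ?mul1r.
  by rewrite mulrCA -def_GH mulrA -polyCM mulVr ?mul1r.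
have pp : prime_elt p by apply/pps/mem_head.
have p0 : p%:P != 0 by rewrite polyC_eq0; case: pp.
have {}IH := IH (fun q qps => pps q (mem_behead (s:=p::ps) qps)).
rewrite big_cons mulrCA polyCM -mulrA => def_GH.
have [_ _ /(_ G H)] := prime_polyC pp; rewrite -def_GH.
case=> [|[G' def_G]|[H' def_H]]; first by exists ((u * \prod_(j <- ps) j)%:P * F).
  have /IH[r1 [r2 [G1 [H1 [def_G' -> ->]]]]] : (u * \prod_(j <- ps) j)%:P * F = G' * H.
    by apply: (mulfI p0); rewrite def_GH def_G mulrA.
  by exists (p * r1), r2, G1, H1; rewrite def_G def_G' polyCM; split=> //; ring.
have /IH[r1 [r2 [G1 [H1 [-> def_H' ->]]]]] : (u * \prod_(j <- ps) j)%:P * F = G * H'.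
  by apply: (mulfI p0); rewrite def_GH def_H mulrCA.
by exists r1, (p * r2), G1, H1; rewrite def_H def_H' polyCM; split=> //; ring.
Qed.

Definition primitive F := forall p, prime_elt p -> ~ divides p%:P F.

Lemma primitive_scalar_unit r F G : primitive G -> G != 0 -> G = r%:P * F ->
  r \is a GRing.unit.
Proof.
move=> pG G0 def_G; apply: NNPP => /negP nu.
have r0 : r != 0 by apply: contraNneq G0 => r0; rewrite def_G r0 mul0r.
have [p pp [s def_r]] := nonunit_prime_divisor fR r0 nu.
by apply: (pG p pp); exists (s%:P * F); rewrite def_G def_r polyCM mulrA.
Qed.

Lemma primitive_divides r F G H : primitive G -> G != 0 -> r != 0 ->
  r%:P * F = G * H -> divides G F.
Proof.
move=> pG G0 r0 /(gauss_split r0)[r1 [r2 [G1 [H1 [def_G _ ->]]]]].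
have ur1 := primitive_scalar_unit pG G0 def_G.
exists (r1^-1%:P * H1); rewrite def_G mulrCA !mulrA -polyCM.
by rewrite mulVr ?mul1r.
Qed.

Lemma primitive_scalar_divisor_unit F c : primitive F -> F != 0 ->
  divides c%:P F -> c \is a GRing.unit.
Proof. by move=> pF F0 [G def_F]; apply: primitive_scalar_unit def_F. Qed.

(** Let F divide G * H and let D be an element of least degree in the ideal
    (F, G).  Pseudo-division makes F and G scalar multiples of multiples of D, so
    by Gauss D is, up to scalars, either F or 1.  In the first case F divides G;
    in the second a scalar lies in (F, G), so F divides a scalar multiple of H. *)
Lemma primitive_irreducible_prime F : (1 < size F)%N -> primitive F ->
    (forall G H, F = G * H -> (size G <= 1)%N \/ (size H <= 1)%N) ->
  prime_elt F.
Proof.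
move=> sF pF iF; have F0 : F != 0 by rewrite -size_poly_gt0; apply: leq_trans sF.
split=> // [|G H FGH]; first by rewrite poly_unitE gtn_eqF.
have [|D [[D0 [a [b def_D]]] minD]] := @exists_minimal {poly R} (fun D => size D)
    (fun D => D != 0 /\ exists a b, D = a * F + b * G).
  by exists F; split=> //; exists 1, 0; ring.
have divD E : (exists a b, E = a * F + b * G) ->
    exists2 l, l != 0 & exists Q, l%:P * E = Q * D.
  move=> [a' [b' def_E]].
  have := Pdiv.WeakIdomain.divp_eq E D; set l := _ ^+ _; rewrite -mul_polyC => eqE.
  exists l; first by rewrite expf_neq0 ?lead_coef_eq0.
  exists (E %/ D)%R; rewrite eqE; have [->|r0] := eqVneq (E %% D) 0; first by rewrite addr0.
  have := minD (E %% D); rewrite leqNgt Pdiv.CommonIdomain.ltn_modpN0 //.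
  move=> H'; suff /H' : E %% D != 0 /\ (exists a b, E %% D = a * F + b * G) by [].
  split=> //; exists (l%:P * a' - E %/ D * a), (l%:P * b' - E %/ D * b).
  apply: (addrI (E %/ D * D)); rewrite -eqE def_E {2}def_D; ring.
have [l l0 [Q]] : exists2 l, l != 0 & exists Q, l%:P * F = Q * D.
  by apply: divD; exists 1, 0; ring.
case/(gauss_split l0)=> [r1 [r2 [Q0 [D1 [_ def_D1 def_F]]]]].
have unitC E E' : F = E * E' -> (size E <= 1)%N -> exists2 c, c \is a GRing.unit & E = c%:P.
  move=> FE /size1_polyC def_E; exists E`_0 => //.
  by apply: (primitive_scalar_divisor_unit pF F0); rewrite -def_E FE; exists E'.
case: (iF _ _ def_F) => [sQ|sD].
  have [c uc def_Q] := unitC _ _ def_F sQ.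
  have [l' l'0 [Q' eqG]] : exists2 l, l != 0 & exists Q, l%:P * G = Q * D.
    by apply: divD; exists 0, 1; ring.
  left; apply: (primitive_divides pF F0 l'0 (H := (r2 * c^-1)%:P * Q')).
  rewrite eqG.
  have -> : Q' * D = Q' * ((r2 * c^-1)%:P * c%:P * D1) by rewrite -polyCM divrK // def_D1.
  rewrite def_F def_Q; ring.
rewrite mulrC in def_F; have [c uc def_D0] := unitC _ _ def_F sD.
right; have r20 : r2 * c != 0.
  by move: D0; rewrite def_D1 def_D0 -polyCM polyC_eq0.
case: FGH => W def_W.
apply: (primitive_divides pF F0 r20 (H := a * H + b * W)).
rewrite polyCM -def_D0 -def_D1 def_D mulrDl mulrDr -mulrA -[b * G * H]mulrA def_W; ring.
Qed.

Lemma content_split F : F != 0 ->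
  exists r G, [/\ r != 0, F = r%:P * G & primitive G].
Proof.
move=> F0; have /fR[u [ps [uu pps def_l]]] : lead_coef F != 0 by rewrite lead_coef_eq0.
have [l] := ubnP (size ps); elim: l => // l IH in F F0 u ps uu pps def_l *.
move=> le_l; have [[p [pp [G def_F]]]|npF] :=
    classic (exists p, prime_elt p /\ divides p%:P F); last first.
  by exists 1, F; split; rewrite ?oner_eq0 ?mul1r // => p pp pF; apply: npF; exists p.
have p0 : p != 0 by case: pp.
have G0 : G != 0 by apply: contraNneq F0 => G0; rewrite def_F G0 mulr0.
have : p * lead_coef G = u * \prod_(q <- ps) q by rewrite -def_l def_F lead_coefM lead_coefC.
case/(prime_cancel pp uu pps)=> v [qs [uv pqs sz def_G]].
have [|r [G1 [r0 def_G1 prG]]] := IH G G0 v qs uv pqs def_G; first by rewrite sz in le_l.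
by exists (p * r), G1; rewrite mulf_neq0 // def_F def_G1 polyCM mulrA.
Qed.

Lemma factorial_prim F : primitive F -> F != 0 -> factors_into_primes F.
Proof.
have [l] := ubnP (size F); elim: l => // l IH in F * => le_l pF F0.
have [s1|s1] := leqP (size F) 1.
  have def_F := size1_polyC s1; exists F, [::]; rewrite big_nil mulr1; split=> //.
  rewrite def_F rmorph_unit //; apply: (primitive_scalar_divisor_unit pF F0).
  by rewrite -def_F; apply: divides_refl.
have [[G [H [def_F sG sH]]]|irr] := classic (exists G H, [/\ F = G * H, (1 < size G)%N & (1 < size H)%N]).
  have pdvd E E' : F = E * E' -> primitive E.
    by move=> FE p pp pE; apply: (pF p pp); rewrite FE; apply: divides_mulr.
  have [G0 H0] : G != 0 /\ H != 0.
    by apply/andP; rewrite -negb_or -mulf_eq0 -def_F.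
  have szF : size F = (size G + size H).-1 by rewrite def_F size_mul.
  have [|u [ps [uu pps def_G]]] := IH G _ (pdvd _ _ def_F) G0.
    by move: sH le_l; rewrite szF; lia.
  have def_F' : F = H * G by rewrite mulrC.
  have [|v [qs [uv pqs def_H]]] := IH H _ (pdvd _ _ def_F') H0.
    by move: sG le_l; rewrite szF; lia.
  exists (u * v), (ps ++ qs); split; first by rewrite unitrM uu.
    by move=> p; rewrite mem_cat => /orP[]; [apply: pps|apply: pqs].
  by rewrite big_cat /= def_F def_G def_H mulrACA.
exists 1, [:: F]; rewrite big_seq1 mul1r; split; rewrite ?unitr1 // => p.
rewrite inE => /eqP ->; apply: primitive_irreducible_prime => // G H def_F.
have [|sG] := leqP (size G) 1; first by left.
have [|sH] := leqP (size H) 1; first by right.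
by case: irr; exists G, H.
Qed.

Theorem factorial_poly : factorial_ring {poly R}.
Proof.
move=> F F0; have [r [G [r0 def_F pG]]] := content_split F0.
have G0 : G != 0 by apply: contraNneq F0 => G0; rewrite def_F G0 mulr0.
have [u [ps [uu pps def_G]]] := factorial_prim pG G0.
have [v [qs [uv pqs def_r]]] := fR r0.
exists (v%:P * u), ([seq p%:P | p <- qs] ++ ps); split.
- by rewrite unitrM uu rmorph_unit.
- by move=> p; rewrite mem_cat => /orP[/mapP[q /pqs pq ->]|/pps //]; apply: prime_polyC.
by rewrite big_cat big_map /= def_F def_G def_r rmorphM rmorph_prod /= mulrACA.
Qed.

End PolynomialsOverFactorialRing.

Lemma factorial_field (K : fieldType) : factorial_ring K.
Proof. by move=> a a0; exists a, [::]; rewrite big_nil mulr1 unitfE. Qed.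

Lemma factorial_iso (C D : idomainType) (f : {rmorphism C -> D}) :
  bijective f -> factorial_ring C -> factorial_ring D.
Proof.
case=> g fK gK fC b b0.
have g1 : g 1 = 1 by apply: (can_inj fK); rewrite gK rmorph1.
have gM x y : g (x * y) = g x * g y by apply: (can_inj fK); rewrite rmorphM !gK.
have unit_f x : x \is a GRing.unit = (f x \is a GRing.unit).
  apply/idP/idP => [/(rmorph_unit f)//|/unitrPr[y xy]].
  by apply/unitrPr; exists (g y); rewrite -[x]fK -gM xy g1.
have div_f x y : divides (f x) y <-> divides x (g y).
  split=> [[z ->]|[z def_y]]; first by exists (g z); rewrite gM fK.
  by exists (f z); rewrite -rmorphM -def_y gK.
have gb0 : g b != 0 by apply: contraNneq b0 => gb0; rewrite -[b]gK gb0 rmorph0.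
have [u [ps [uu pps def_b]]] := fC _ gb0.
exists (f u), (map f ps); split; first by rewrite -unit_f.
  move=> _ /mapP[p /pps[p0 pu pp] ->]; split.
  - by apply: contraNneq p0 => fp0; rewrite -[p]fK fp0 -(rmorph0 f) fK.
  - by rewrite -unit_f.
  by move=> x y /div_f; rewrite gM => /pp[] ?; [left|right]; apply/div_f.
by rewrite -[b]gK def_b rmorphM rmorph_prod big_map.
Qed.

(** * Separating the last variable *)

Lemma mmap_id n (R : nzRingType) (p : {mpoly R[n]}) :
  mmap (@mpolyC n R) (fun i => 'X_i) p = p.
Proof.
rewrite [RHS]mpolyE; apply: eq_bigr => m _.
by rewrite mmap1_id mul_mpolyC.
Qed.

Section LastVariable.

Variables (n : nat) (R : idomainType).

Lemma mmap_muni (S : comNzRingType) (f : {rmorphism R -> S}) (h : 'I_n.+1 -> S)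
    (p : {mpoly R[n.+1]}) :
  mmap f h p =
  (map_poly (mmap f (fun i => h (widen_ord (leqnSn n) i))) (muni p)).[h ord_max].
Proof.
rewrite muniE [LHS]/mmap.
rewrite rmorph_sum horner_sum; apply: eq_bigr => m _ /=.
rewrite -mul_polyC rmorphM /= map_polyC map_polyXn hornerCM hornerXn /=.
rewrite mmapZ mmapX.
rewrite -mulrA; congr (_ * _); rewrite /mmap1 big_ord_recr /=; congr (_ * _).
by apply: eq_bigr => i _; rewrite mnmE.
Qed.

Lemma muni_mwiden (q : {mpoly R[n]}) : muni (mwiden q) = q%:P.
Proof.
elim/mpolyind: q => [|c m p _ _ IH]; first by rewrite mwiden0 muni0.
rewrite mwidenD muniD IH polyCD; congr (_ + _).
rewrite mwidenZ mwidenX muniZ muniE msuppX big_seq1 mcoeffX eqxx scale1r.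
rewrite mnmwiden_ordmax -!mul_polyC mulr1 -polyCM mul_mpolyC; congr (_ *: 'X_[_])%:P.
by apply/mnmP => i; rewrite mnmE mnmwiden_widen.
Qed.

Definition of_muni (P : {poly {mpoly R[n]}}) : {mpoly R[n.+1]} :=
  (map_poly (@mwiden n R) P).['X_ord_max].

Lemma muniK : cancel (@muni n R) of_muni.
Proof.
move=> p; rewrite /of_muni -[RHS]mmap_id.
by rewrite mmap_muni.
Qed.

Lemma of_muniK : cancel of_muni (@muni n R).
Proof.
elim/poly_ind => [|P c IH]; first by rewrite /of_muni !rmorph0 horner0 rmorph0.
rewrite /of_muni rmorphD rmorphM /= map_polyX map_polyC hornerMXaddC.
rewrite rmorphD rmorphM /= muni_mwiden -/(of_muni P) IH; congr (_ * _ + _).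
rewrite muniE msuppX big_seq1 mcoeffX eqxx scale1r mnmE eqxx.
rewrite (_ : [multinom _ | _ < _] = 0%MM) ?mpolyX0 ?scale1r //.
apply/mnmP => i; rewrite !mnmE; case: eqP => // /(congr1 val) /= iE.
by have := ltn_ord i; rewrite -iE ltnn.
Qed.

Lemma muni_inj : injective (@muni n R).
Proof. exact: can_inj muniK. Qed.

Fact of_muni_is_zmod_morphism : zmod_morphism of_muni.
Proof. by move=> P Q; apply: muni_inj; rewrite raddfB /= !of_muniK. Qed.

Fact of_muni_is_monoid_morphism : monoid_morphism of_muni.
Proof.
split=> [|P Q]; apply: muni_inj; first by rewrite of_muniK rmorph1.
by rewrite rmorphM /= !of_muniK.
Qed.

HB.instance Definition _ := GRing.isZmodMorphism.Build _ _ of_muni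
  of_muni_is_zmod_morphism.
HB.instance Definition _ := GRing.isMonoidMorphism.Build _ _ of_muni
  of_muni_is_monoid_morphism.

End LastVariable.

Lemma factorial_mpoly (K : fieldType) n : factorial_ring {mpoly K[n]}.
Proof.
elim: n => [|n IH].
  apply: (@factorial_iso K _ (@mpolyC 0 K)); last exact: factorial_field.
  exists (mcoeff 0%MM) => [c|p]; first by rewrite mcoeffC eqxx mulr1.
  by rewrite [RHS]nvar0_mpolyC.
apply: (@factorial_iso {poly {mpoly K[n]}} _ (@of_muni n K)); last exact: factorial_poly.
by exists (@muni n K); [apply: of_muniK|apply: muniK].
Qed.

(** * Retracts of polynomial rings are factorial *)

Section ConstantPolynomials.

Variables (k : fieldType) (n : nat).
Implicit Types p q : {mpoly k[n]}.

Definition is_const p := (msize p <= 1)%N.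

Lemma is_constP p : reflect (exists c, p = c%:MP) (is_const p).
Proof.
apply: (iffP idP) => [/msize1_polyC ->|[c ->]]; first by eexists.
by rewrite /is_const msizeC; case: (c != 0).
Qed.

Lemma is_const_factor p q : p * q != 0 -> is_const (p * q) -> is_const p.
Proof.
move=> pq0; have : (p != 0) && (q != 0) by rewrite -negb_or -mulf_eq0.
case/andP=> p0 q0; rewrite /is_const msizeM //.
move: p0 q0; rewrite -!msize_poly_eq0; case: (msize p) => // a _.
case: (msize q) => // b _; lia.
Qed.

Lemma is_const_unit p : p \is a GRing.unit -> is_const p.
Proof.
move=> /unitrPr[q pq1]; apply: (@is_const_factor p q); rewrite pq1 ?oner_eq0 //.
by rewrite /is_const msize1.
Qed.

End ConstantPolynomials.

Section RetractFactorization.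

Variables (k : fieldType) (n : nat) (h : n.-tuple {mpoly k[n]}).
Local Notation P := {mpoly k[n]}.
Local Notation phi := (comp_mpoly h).
Implicit Types (a b p q u v : P).

Hypothesis idem : forall p, phi (phi p) = phi p.

(** As phi is idempotent, its image is the set of its fixed points. *)
Definition retr p := phi p = p.

Lemma retr_phi p : retr (phi p). Proof. exact: idem. Qed.

Lemma retr0 : retr 0. Proof. exact: rmorph0. Qed.
Lemma retrC c : retr c%:MP. Proof. exact: comp_mpolyC. Qed.
Lemma retrD a b : retr a -> retr b -> retr (a + b).
Proof. by rewrite /retr rmorphD /= => -> ->. Qed.
Lemma retrM a b : retr a -> retr b -> retr (a * b).
Proof. by rewrite /retr rmorphM /= => -> ->. Qed.
Lemma retrZ c a : retr a -> retr (c *: a).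
Proof. by rewrite /retr linearZ /= => ->. Qed.
Lemma retrX a i : retr a -> retr (a ^+ i).
Proof. by rewrite /retr rmorphXn /= => ->. Qed.

Lemma retr_quotient a b : a != 0 -> retr a -> retr (a * b) -> retr b.
Proof. by rewrite /retr rmorphM /= => a0 -> /(mulfI a0). Qed.

(** Primality inside the retract: p need not be prime in the ambient ring. *)
Definition retr_prime p := [/\ retr p, ~~ is_const p &
  forall u v, retr u -> retr v -> divides p (u * v) -> divides p u \/ divides p v].

Lemma retr_prime_neq0 p : retr_prime p -> p != 0.
Proof. by case=> _ np _; apply: contraNneq np => ->; rewrite /is_const msize0. Qed.

Definition retr_irreducible a :=
  forall u v, retr u -> retr v -> a = u * v -> is_const u \/ is_const v.

Lemma irreducible_prod a (c : k) qs : retr_irreducible a -> ~~ is_const a ->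
    (forall q, q \in qs -> retr q) -> a = c *: \prod_(q <- qs) q ->
  exists2 q, q \in qs & exists2 d : k, d != 0 & a = d *: q.
Proof.
move=> ia na; elim: qs c => [|q qs IH] c rqs.
  rewrite big_nil => def_a; case/negP: na; apply/is_constP; exists c.
  by rewrite def_a -mul_mpolyC mulr1.
rewrite big_cons => def_a; have rq := rqs _ (mem_head _ _).
have {}rqs r : r \in qs -> retr r by move=> rs; apply: rqs; rewrite inE rs orbT.
have rqs' : retr (c *: \prod_(j <- qs) j).
  apply: retrZ; rewrite big_seq; elim/big_rec: _ => [|r x rr]; first exact: rmorph1.
  by apply: retrM; apply: rqs.
case: (ia q (c *: \prod_(j <- qs) j)) => //; first by rewrite def_a scalerAr.
  case/is_constP=> e def_q.
  have [|r rqs1 [d d0 def_a']] := IH (c * e) rqs.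
    by rewrite def_a def_q mul_mpolyC scalerA.
  by exists r; [rewrite inE rqs1 orbT | exists d].
case/is_constP=> d def_d; exists q; first exact: mem_head.
exists d; last by rewrite def_a scalerAr def_d mulrC mul_mpolyC.
by apply: contraNneq na => d0; rewrite def_a scalerAr def_d d0 mulr0 /is_const msize0.
Qed.

(** Factor a in the polynomial ring and apply the retraction: by irreducibility
    a is a scalar multiple of the image of one of its prime factors p.  If a
    divides u * v, then p divides, say, u, hence phi p divides phi u = u. *)
Lemma irreducible_retr_prime a : retr a -> ~~ is_const a ->
  retr_irreducible a -> retr_prime a.
Proof.
move=> ra na ia; split=> // u v ru rv auv.
have a0 : a != 0 by apply: contraNneq na => ->; rewrite /is_const msize0.
have [w [ps [uw pps def_a]]] := factorial_mpoly a0.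
have /is_constP[c def_w] := is_const_unit uw.
have [||p' /mapP[p pps' ->] [d d0 def_ap]] := @irreducible_prod a c (map phi ps) ia na.
- by move=> _ /mapP[p _ ->]; apply: retr_phi.
- by rewrite -[LHS]ra def_a def_w rmorphM rmorph_prod big_map /= comp_mpolyC mul_mpolyC.
have pa : divides p a.
  by rewrite def_a (big_rem _ pps') /= mulrCA; eexists.
have [_ _ /(_ u v (divides_trans pa auv)) pdvd] := pps _ pps'.
have step x : retr x -> divides p x -> divides a x.
  move=> rx [y def_x]; exists (d^-1 *: phi y).
  rewrite {1}def_ap -scalerAr -scalerAl scalerA mulVf // scale1r.
  by rewrite -rmorphM /= -def_x rx.
by case: pdvd => /step ?; [left|right]; auto.
Qed.

Theorem retr_factorization a : retr a -> a != 0 -> exists (c : k) ps,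
  [/\ c != 0, forall p, p \in ps -> retr_prime p & a = c *: \prod_(p <- ps) p].
Proof.
have [l] := ubnP (msize a); elim: l => // l IH in a * => le_l ra a0.
have [/is_constP[c def_a]|na] := boolP (is_const a).
  exists c, [::]; rewrite big_nil -mul_mpolyC mulr1; split=> //.
  by apply: contraNneq a0 => c0; rewrite def_a c0.
have [[u [v [ru rv [def_a nu nv]]]]|ia] := classic (exists u v, [/\ retr u, retr v
     & [/\ a = u * v, ~~ is_const u & ~~ is_const v]]).
  have /andP[u0 v0] : (u != 0) && (v != 0) by rewrite -negb_or -mulf_eq0 -def_a.
  move: nu nv le_l; rewrite /is_const def_a msizeM // => nu nv le_l.
  have [|c [ps [c0 pps def_u]]] := IH u _ ru u0; first by clear -nv le_l; move: (msize u) (msize v) nv le_l => x y; lia.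
  have [|d [qs [d0 pqs def_v]]] := IH v _ rv v0; first by clear -nu le_l; move: (msize u) (msize v) nu le_l => x y; lia.
  exists (c * d), (ps ++ qs); rewrite mulf_neq0 //; split=> //.
    by move=> p; rewrite mem_cat => /orP[]; [apply: pps|apply: pqs].
  by rewrite def_u def_v big_cat /= -scalerAl -scalerAr scalerA.
exists 1, [:: a]; rewrite oner_eq0 big_seq1 scale1r; split=> // p.
rewrite inE => /eqP ->; apply: irreducible_retr_prime => // u v ru rv def_a.
apply: NNPP => nuv; apply: ia; exists u, v; split=> //; split=> //.
  by apply/negP => cu; apply: nuv; left.
by apply/negP => cv; apply: nuv; right.
Qed.

End RetractFactorization.

(** * Bounding transcendence degrees by counting monomials *)

Section LinearDependence.

Variables (k K : fieldType) (iota : {rmorphism k -> K}).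

Lemma more_vectors_dependent (I J : finType) (e : I -> K) (y : J -> K) :
    (#|I| < #|J|)%N ->
    (forall j, exists c : I -> k, y j = \sum_i iota (c i) * e i) ->
  exists2 c : J -> k, exists j, c j != 0 & \sum_j iota (c j) * y j = 0.
Proof.
move=> ltIJ span_y.
have [c yE] : exists c : J -> I -> k, forall j, y j = \sum_i iota (c j i) * e i.
  have [c yE] := fin_all_exists span_y; by exists c.
pose M := \matrix_(j < #|J|, i < #|I|) c (enum_val j) (enum_val i).
have : kermx M != 0.
  rewrite kermx_eq0 /row_free; apply: contraTneq ltIJ => <-.
  by rewrite -leqNgt rank_leq_col.
case/rowV0Pn=> v /sub_kermxP vM v0.
exists (fun j => v 0 (enum_rank j)).
  have /rV0Pn[j vj] := v0; exists (enum_val j); by rewrite enum_valK.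
under eq_bigr => j _ do rewrite yE mulr_sumr.
rewrite exchange_big big1 //= => i _.
under eq_bigr => j _ do rewrite mulrA -rmorphM.
rewrite -mulr_suml -rmorph_sum /=.
have /rowP/(_ (enum_rank i)) := vM; rewrite !mxE => vMi.
rewrite (_ : \sum_j _ = 0) ?rmorph0 ?mul0r // -[RHS]vMi.
rewrite (reindex _ (onW_bij _ (@enum_val_bij J))) /=.
by apply: eq_bigr => j _; rewrite mxE enum_valK enum_rankK.
Qed.

End LinearDependence.

Section TranscendenceBound.

Variables (k K : fieldType) (iota : {rmorphism k -> K}).
Variables (d m : nat) (t : 'I_d -> K) (a : 'I_m -> K).
Local Notation ev := (mmap iota t).

Lemma common_denominator (x : nat -> K) s :
  (forall j, adjoined iota t (x j)) ->
  exists2 D, ev D != 0 & forall j, (j < s)%N -> exists N, ev D * x j = ev N.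
Proof.
move=> adj_x; elim: s => [|s [D D0 IH]]; first by exists 1; rewrite ?rmorph1 ?oner_eq0.
have [p [q [q0 xs]]] := adj_x s.
exists (D * q); first by rewrite rmorphM mulf_neq0.
move=> j; rewrite ltnS leq_eqVlt => /predU1P[->|/IH[N eqN]].
  by exists (D * p); rewrite !rmorphM xs /= -mulrA; congr (_ * _); rewrite mulrCA divff ?mulr1.
by exists (N * q); rewrite !rmorphM /= -eqN mulrAC.
Qed.

Definition alg_relation (r : nat) (y : K) := exists (L : {mpoly k[d]})
    (N : 'I_r -> {mpoly k[d]}),
  ev L != 0 /\ ev L * y ^+ r = \sum_(j < r) ev (N j) * y ^+ j.

Lemma algebraic_relation y : algebraic_over (adjoined iota t) y ->
  exists2 r, (0 < r)%N & alg_relation r y.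
Proof.
case=> Q [Q0 adjQ rootQ].
have [D D0 eqD] := common_denominator (size Q) adjQ.
have szQ : (1 < size Q)%N by apply: root_size_gt1 rootQ.
have sE : size Q = (size Q).-1.+1 by rewrite prednK // ltnW.
have [N eqN] : exists N : 'I_(size Q).-1.+1 -> {mpoly k[d]},
    forall j : 'I_(size Q).-1.+1, ev D * Q`_j = ev (N j).
  have lt_j (j : 'I_(size Q).-1.+1) : (j < size Q)%N by rewrite [X in (_ < X)%N]sE.
  by have [N eqN] := fin_all_exists (fun j : 'I_(size Q).-1.+1 => eqD j (lt_j j)); exists N.
exists (size Q).-1; first by case: (size Q) szQ => [|[]].
exists (N ord_max), (fun j => - N (widen_ord (leqnSn _) j)); split.
  by rewrite -eqN mulf_neq0 //= -lead_coefE lead_coef_eq0.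
have /rootP := rootQ; rewrite (@horner_coef_wide _ (size Q).-1.+1) -?sE // => Qy.
apply/eqP; rewrite -subr_eq0 -sumrN addrC; apply/eqP.
transitivity (ev D * 0); last by rewrite mulr0.
rewrite -[in RHS]Qy mulr_sumr [RHS]big_ord_recr /=; congr (_ + _).
  by apply: eq_bigr => j _; rewrite rmorphN mulNr opprK mulrA /= -eqN.
by rewrite mulrA -eqN.
Qed.

Lemma alg_relation_raise r s y : alg_relation r y -> alg_relation (s + r) y.
Proof.
move=> rel; elim: s => // s; rewrite addSn; move: (s + r)%N => {rel r}r [L [N [L0 rel]]].
exists L, (fun j : 'I_r.+1 => if unlift ord0 j is Some i then N i else 0).
split=> //; rewrite exprS mulrCA rel mulr_sumr big_ord_recl.
rewrite unlift_none rmorph0 mul0r add0r; apply: eq_bigr => j _.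
by rewrite liftK mulrCA -exprS.
Qed.

Hypothesis alg_a : forall i, algebraic_over (adjoined iota t) (a i).

(** A common exponent r for all the a_i lets the powers a^b with all b_i < r
    serve as one spanning family. *)
Lemma uniform_relation : exists2 r, (0 < r)%N & forall i, alg_relation r (a i).
Proof.
have ex_r i : exists r, (0 < r)%N /\ alg_relation r (a i).
  by have [r ? ?] := algebraic_relation (alg_a i); exists r.
have [r_ rP] := fin_all_exists ex_r.
exists (\max_i r_ i).+1 => // i; have [_ rel] := rP i.
have le_r : (r_ i <= (\max_i r_ i).+1)%N by rewrite ltnW // ltnS leq_bigmax.
by rewrite -(subnK le_r); apply: alg_relation_raise.
Qed.

Section Span.

Variables (r : nat).
Implicit Type b : {ffun 'I_m -> 'I_r}.

Definition monom b := \prod_i a i ^+ b i.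
(** Combinations of the monomials a^b, b_i < r, whose coefficients are
    polynomials of degree at most c in t. *)
Definition in_span c x := exists Q : {ffun 'I_m -> 'I_r} -> {mpoly k[d]},
  (forall b, msize (Q b) <= c.+1)%N /\ x = \sum_b ev (Q b) * monom b.

Lemma in_span_monom c R b : (msize R <= c.+1)%N -> in_span c (ev R * monom b).
Proof.
move=> sR; exists (fun b' => if b' == b then R else 0); split.
  by move=> b'; case: eqP => // _; rewrite msize0.
rewrite (bigD1 b) //= eqxx big1 ?addr0 // => b' /negbTE->.
by rewrite rmorph0 mul0r.
Qed.

Lemma in_span_sum c (I : finType) (F : I -> K) :
  (forall i, in_span c (F i)) -> in_span c (\sum_i F i).
Proof.
move=> spF; have [Q QP] := fin_all_exists spF.
exists (fun b => \sum_i Q i b); split=> [b|].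
  apply: leq_trans (msize_sum _ _ _) _; apply/bigmax_leqP_seq => i _ _.
  by case: (QP i).
under eq_bigr => i _ do have [_ ->] := QP i.
rewrite exchange_big; apply: eq_bigr => b _.
by rewrite rmorph_sum mulr_suml.
Qed.

Lemma in_span_mul c e x R : (msize R <= e.+1)%N -> in_span c x ->
  in_span (c + e) (ev R * x).
Proof.
move=> sR [Q [sQ ->]]; exists (fun b => R * Q b); split=> [b|].
  have [->|R0] := eqVneq R 0; first by rewrite mul0r msize0.
  have [->|Q0] := eqVneq (Q b) 0; first by rewrite mulr0 msize0.
  rewrite msizeM //; have := sQ b; move: (msize R) (msize (Q b)) sR => u v; lia.
by rewrite mulr_sumr; apply: eq_bigr => b _; rewrite rmorphM mulrA.
Qed.

Definition upd b i j : {ffun 'I_m -> 'I_r} := [ffun l => if l == i then j else b l].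

Lemma monom_upd b i j : monom (upd b i j) = a i ^+ j * \prod_(l | l != i) a l ^+ b l.
Proof.
rewrite /monom (bigD1 i) //= ffunE eqxx; congr (_ * _).
by apply: eq_bigr => l /negbTE nl; rewrite ffunE nl.
Qed.

Lemma monom_split b i : monom b = a i ^+ b i * \prod_(l | l != i) a l ^+ b l.
Proof. by rewrite /monom (bigD1 i). Qed.

(** Multiplication by L a_i raises the degree in t by at most e: if the exponent
    of a_i overflows, the relation satisfied by a_i brings it back. *)
Lemma in_span_step c e x i L (N : 'I_r -> {mpoly k[d]}) :
    (msize L <= e.+1)%N -> (forall j, msize (N j) <= e.+1)%N ->
    ev L * a i ^+ r = \sum_(j < r) ev (N j) * a i ^+ j ->
  in_span c x -> in_span (c + e) (ev L * a i * x).
Proof.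
move=> sL sN rel [Q [sQ ->]]; rewrite mulr_sumr; apply: in_span_sum => b.
rewrite mulrCA addnC; apply: in_span_mul => //.
rewrite (monom_split b i) -!mulrA [a i * _]mulrA -exprS.
have [ltr|] := ltnP (b i).+1 r.
  by rewrite -(monom_upd b i (Ordinal ltr)); apply: in_span_monom.
rewrite leq_eqVlt ltnS [(r <= b i)%N]leqNgt ltn_ord orbF => /eqP rE; rewrite -rE.
rewrite mulrA rel mulr_suml; apply: in_span_sum => j.
by rewrite -mulrA -monom_upd; apply: in_span_monom.
Qed.

End Span.

(** Each power of a_i is cleared by as many factors L_i, so that the degree in t
    grows linearly with the bound on the exponents. *)
Lemma span_powers r c e (L : 'I_m -> {mpoly k[d]}) (N : 'I_m -> 'I_r -> {mpoly k[d]}) x :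
    (forall i, msize (L i) <= e.+1)%N -> (forall i j, msize (N i j) <= e.+1)%N ->
    (forall i, ev (L i) * a i ^+ r = \sum_(j < r) ev (N i j) * a i ^+ j) ->
    in_span r c x ->
  forall s (g : 'I_m -> nat), (forall i, g i <= s)%N ->
  in_span r (c + m * s * e) (\prod_i (ev (L i) ^+ s * a i ^+ g i) * x).
Proof.
move=> sL sN rel spx s g le_gs.
have step i j c' z : (j <= s)%N -> in_span r c' z ->
    in_span r (c' + s * e) (ev (L i) ^+ s * a i ^+ j * z).
  elim: s {g le_gs} j => [|s IH] j.
    by rewrite leqn0 => /eqP->; rewrite mul0n addn0 !mul1r.
  rewrite mulSnr addnA => le_js spz; have [le_js'|lt_sj] := leqP j s.
    by rewrite exprS -!mulrA; apply: in_span_mul => //; rewrite mulrA; apply: IH.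
  have -> : j = s.+1 by apply/eqP; rewrite eqn_leq le_js.
  rewrite [X in X * z](_ : _ = ev (L i) * a i * (ev (L i) ^+ s * a i ^+ s)); last first.
    by rewrite !exprS mulrACA.
  by rewrite -mulrA; apply: in_span_step => //; apply: IH.
have -> : (m * s * e = \sum_(i < m) s * e)%N by rewrite sum_nat_const card_ord mulnA.
elim/big_rec2: _ => [|i c' z _ IH]; first by rewrite addn0 mul1r.
by rewrite -mulrA addnCA addnC; apply: step.
Qed.

Lemma in_span_finite r c x : in_span r c x ->
  exists w : 'X_{1..d < c.+1} * {ffun 'I_m -> 'I_r} -> k,
  x = \sum_i iota (w i) * (mmap1 t i.1 * monom i.2).
Proof.
case=> Q [sQ ->]; exists (fun i : 'X_{1..d < c.+1} * {ffun 'I_m -> 'I_r} => (Q i.2)@_(i.1)).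
rewrite -(pair_bigA _ (fun (u : 'X_{1..d < c.+1}) b => iota (Q b)@_u * (mmap1 t u * monom b))).
rewrite exchange_big /=; apply: eq_bigr => b _.
rewrite (mmapE c.+1) // mulr_suml; apply: eq_bigr => u _.
by rewrite mulrA.
Qed.

Lemma card_bmultinom_le c : (#|{: 'X_{1..d < c.+1}}| <= c.+1 ^ d)%N.
Proof.
pose f (u : 'X_{1..d < c.+1}) : {ffun 'I_d -> 'I_c.+1} := [ffun l => inord (u l)].
suff /leq_card : injective f by rewrite card_ffun !card_ord.
have le_u (u : 'X_{1..d < c.+1}) l : (u l < c.+1)%N.
  apply: leq_ltn_trans (bmdeg u); rewrite mdegE (bigD1 l) //=; exact: leq_addr.
move=> u v /ffunP eq_uv; apply/val_inj/mnmP => l.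
by have := eq_uv l; rewrite !ffunE => /(congr1 val); rewrite /= !inordK.
Qed.

(** The (s + 1)^m monomials a^g with g_i <= s, multiplied by a fixed denominator,
    lie in the span of O(s^d) elements.  As d < m they are linearly dependent for
    s large. *)
Theorem trdeg_bound : (d < m)%N -> exists2 p, p != 0 & mmap iota a p = 0.
Proof.
move=> lt_dm; have [r r0 rel] := uniform_relation.
have [L LP] := fin_all_exists rel; have [N NP] := fin_all_exists LP.
pose e := (\max_i maxn (msize (L i)) (\max_j msize (N i j)))%N.
have sL i : (msize (L i) <= e.+1)%N.
  rewrite ltnW // ltnS; apply: leq_trans (leq_bigmax i); exact: leq_maxl.
have sN i j : (msize (N i j) <= e.+1)%N.
  rewrite ltnW // ltnS; apply: leq_trans (leq_bigmax i); apply: leq_trans (leq_maxr _ _).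
  exact: leq_bigmax.
(* chosen so that (m * s * e + 1)^d * r^m < (s + 1)^(d + 1) *)
pose s := ((m * e).+1 ^ d * r ^ m)%N.
pose y (g : {ffun 'I_m -> 'I_s.+1}) := \prod_i (ev (L i) ^+ s * a i ^+ g i).
have [||w [g0 wg0] rel0] := @more_vectors_dependent k K iota _ _
    (fun i : 'X_{1..d < (m * s * e).+1} * {ffun 'I_m -> 'I_r} => mmap1 t i.1 * monom i.2) y.
- rewrite card_prod [X in (_ * X < _)%N]card_ffun [X in (_ < X)%N]card_ffun !card_ord.
  apply: leq_ltn_trans (leq_mul (card_bmultinom_le _) (leqnn _)) _.
  apply: (@leq_ltn_trans (((m * e).+1 * s.+1) ^ d * r ^ m)).
    have mono x z l : (x <= z)%N -> (x ^ l <= z ^ l)%N.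
      by move=> le_xz; elim: l => // l IH; rewrite !expnS leq_mul.
    by rewrite leq_mul2r mono ?orbT //; nia.
  rewrite expnMn mulnAC -/s; apply: (@leq_trans (s.+1 * s.+1 ^ d)).
    by rewrite ltn_mul2r expn_gt0 ltnSn.
  by rewrite -expnS; apply: leq_pexp2l.
- move=> g; apply: in_span_finite.
  rewrite -[y g]mulr1 -[X in in_span _ X]add0n.
  apply: (span_powers sL sN) => [i||i]; first by case: (NP i).
    rewrite (_ : 1 = ev 1 * monom [ffun=> Ordinal r0]); first by apply: in_span_monom; rewrite msize1.
    by rewrite rmorph1 mul1r /monom big1 // => i _; rewrite ffunE.
  by rewrite -ltnS.
exists (\sum_(g : {ffun 'I_m -> 'I_s.+1}) w g *: 'X_[[multinom (g l : nat) | l < m]]).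
  apply/eqP => /mpolyP/(_ [multinom (g0 l : nat) | l < m]); rewrite mcoeff0 raddf_sum /=.
  rewrite (bigD1 g0) //= mcoeffZ mcoeffX eqxx mulr1 big1 ?addr0 => [wg|g].
    by rewrite wg eqxx in wg0.
  move=> ne; rewrite mcoeffZ mcoeffX; case: eqP => [/mnmP eqg|]; last by rewrite mulr0.
  by case/eqP: ne; apply/ffunP => l; apply/val_inj; have := eqg l; rewrite !mnmE.
have D0 : \prod_i (ev (L i) ^+ s) != 0.
  by apply/prodf_neq0 => i _; rewrite expf_neq0 //; case: (NP i).
apply: (mulfI D0); rewrite mulr0 -[RHS]rel0 rmorph_sum mulr_sumr /=.
apply: eq_bigr => g _; rewrite mmapZ mmapX mulrCA; congr (_ * _).
rewrite /y /mmap1 -big_split; apply: eq_bigr => i _ /=; by rewrite mnmE.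
Qed.

End TranscendenceBound.

(** * Algebraic relations *)

Section NestedEvaluation.

Variables (R : nzRingType) (S : comNzRingType) (f : {rmorphism R -> S}) (w : S).

Definition evp (p : {poly R}) : S := (map_poly f p).[w].

Fact evp_is_zmod_morphism : zmod_morphism evp.
Proof. by move=> p q; rewrite /evp rmorphB /= hornerD hornerN. Qed.

Fact evp_is_monoid_morphism : monoid_morphism evp.
Proof. by split=> [|p q]; rewrite /evp ?rmorph1 ?hornerC // rmorphM /= hornerM. Qed.

HB.instance Definition _ := GRing.isZmodMorphism.Build _ _ evp evp_is_zmod_morphism.
HB.instance Definition _ := GRing.isMonoidMorphism.Build _ _ evp evp_is_monoid_morphism.

Lemma evpC c : evp c%:P = f c.
Proof. by rewrite /evp map_polyC hornerC. Qed.

Lemma evpX : evp 'X = w.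
Proof. by rewrite /evp map_polyX hornerX. Qed.

Lemma evp_sum p : evp p = \sum_(i < size p) f p`_i * w ^+ i.
Proof.
rewrite /evp (@horner_coef_wide _ (size p)) ?size_poly //.
by apply: eq_bigr => i _; rewrite coef_map.
Qed.

End NestedEvaluation.

Lemma rmorph_evp (R : nzRingType) (S T : comNzRingType) (f : {rmorphism R -> S})
    (g : {rmorphism S -> T}) (w : S) p :
  g (evp f w p) = evp (g \o f) (g w) p.
Proof. by rewrite /evp -horner_map -map_poly_comp. Qed.

Lemma rmorph_mmap (R : nzRingType) (S T : comNzRingType) m (f : {rmorphism R -> S})
    (g : {rmorphism S -> T}) (a : 'I_m -> S) p :
  g (mmap f a p) = mmap (g \o f) (g \o a) p.
Proof.
rewrite /mmap rmorph_sum; apply: eq_bigr => u _; rewrite rmorphM /= /mmap1 rmorph_prod.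
by congr (_ * _); apply: eq_bigr => i _; rewrite rmorphXn.
Qed.

Lemma eq_mmap (R : nzRingType) (S : comNzRingType) m (f g : R -> S) (a b : 'I_m -> S) p :
  f =1 g -> a =1 b -> mmap f a p = mmap g b p.
Proof.
by move=> fg ab; apply: eq_bigr => u _; rewrite fg (mmap1_eq _ ab).
Qed.

(** Dividing a relation by a power of its last variable w, one may assume that its
    constant term does not vanish; that term then takes a value divisible by w. *)
Lemma evp_divides (R : nzRingType) (S : idomainType) (f : {rmorphism R -> S})
    (w : S) (Q : {poly R}) : w != 0 -> Q != 0 -> evp f w Q = 0 ->
  exists2 p, p != 0 & exists Q', f p = w * evp f w Q'.
Proof.
move=> w0; elim/poly_ind: Q => [|Q c IH]; first by rewrite eqxx.
rewrite rmorphD rmorphM /= evpX evpC; have [->|c0 _] := eqVneq c 0.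
  rewrite !rmorph0 !addr0 => QX0 /eqP; rewrite mulf_eq0 (negbTE w0) orbF => /eqP.
  by apply: IH; apply: contraNneq QX0 => ->; rewrite mul0r.
move/eqP; rewrite addr_eq0 eq_sym eqr_oppLR => /eqP def_fc.
by exists c => //; exists (- Q); rewrite def_fc rmorphN mulrN mulrC.
Qed.

Lemma evp_restrict0 (R : nzRingType) (S T : idomainType) (f : {rmorphism R -> S})
    (g : {rmorphism S -> T}) (w : S) (Q : {poly R}) :
    w != 0 -> g w = 0 -> Q != 0 -> evp f w Q = 0 ->
  exists2 p, p != 0 & g (f p) = 0.
Proof.
move=> w0 gw Q0 rel; have [p p0 [Q' fp]] := evp_divides w0 Q0 rel.
by exists p; rewrite // fp rmorphM gw mul0r.
Qed.

Section Dependence.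

Variables (k : fieldType).

Lemma mpoly_dependent_embedded d m (K : fieldType) (g : {rmorphism {mpoly k[d]} -> K})
    (a : 'I_m -> {mpoly k[d]}) : injective g -> (d < m)%N ->
  exists2 p : {mpoly k[m]}, p != 0 & mmap (@mpolyC d k) a p = 0.
Proof.
move=> g_inj lt_dm; pose t (i : 'I_d) : K := g 'X_i.
have evE q : mmap (g \o @mpolyC d k) t q = g q.
  transitivity (g (mmap (@mpolyC d k) (fun i => 'X_i) q)); first by rewrite rmorph_mmap.
  by rewrite mmap_id.
have [|p p0 rel] := @trdeg_bound k K (g \o @mpolyC d k) d m t (fun i => g (a i)) _ lt_dm.
  move=> i; exists ('X - (g (a i))%:P); split.
  - by rewrite polyXsubC_eq0.
  - move=> j; exists (if j is 0 then - a i else if j is 1%N then 1 else 0), 1.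
    rewrite !evE rmorph1 oner_eq0 divr1; split=> //; rewrite coefB coefX coefC.
    by case: j => [|[|j]] /=; rewrite ?sub0r ?subr0 ?rmorphN ?rmorph1 ?rmorph0 ?oppr0.
  - by rewrite root_XsubC.
by exists p => //; apply: g_inj; rewrite rmorph0 rmorph_mmap.
Qed.

Lemma mpoly_dependent d m (a : 'I_m -> {mpoly k[d]}) : (d < m)%N ->
  exists2 p : {mpoly k[m]}, p != 0 & mmap (@mpolyC d k) a p = 0.
Proof.
apply: (mpoly_dependent_embedded (g := @tofrac {mpoly k[d]})) => p q /eqP.
by rewrite tofrac_eq => /eqP.
Qed.

(** The d + 1 polynomials a_i and g in d variables satisfy a relation, which may
    be assumed not divisible by the variable standing for g.  Its image under f
    is a relation between the f a_i since f g = 0. *)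
Lemma kernel_dependent d (T : idomainType) (f : {rmorphism {mpoly k[d]} -> T})
    (a : 'I_d -> {mpoly k[d]}) g : g != 0 -> f g = 0 ->
  exists2 p : {mpoly k[d]}, p != 0 & mmap (f \o @mpolyC d k) (f \o a) p = 0.
Proof.
move=> g0 fg0.
pose b (i : 'I_d.+1) := if insub (val i) is Some j then a j else g.
have [Q Q0] := mpoly_dependent b (ltnSn d).
rewrite mmap_muni -/(evp _ _ _) => rel.
have bE i : b (widen_ord (leqnSn d) i) = a i by rewrite /b /= valK.
have bmax : b ord_max = g by rewrite /b insubN //= ltnn.
have [|||p p0 fp] := evp_restrict0 (g := f) _ _ _ rel.
- by rewrite bmax.
- by rewrite bmax.
- by apply: contraNneq Q0 => Q0; apply/eqP/muni_inj; rewrite Q0 muni0.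
exists p => //; transitivity (f (mmap (@mpolyC d k) a p)); first by rewrite rmorph_mmap.
by rewrite -fp; congr (f _); apply: eq_mmap => // i; rewrite bE.
Qed.

(** Iterated univariate polynomials: the last variable, which carries the degree
    in the applications below, is outermost. *)
Definition nest1 : {rmorphism {mpoly k[1]} -> {poly k}} :=
  map_poly (mcoeff 0%MM) \o @muni 0 k.
Definition nest2 : {rmorphism {mpoly k[2]} -> {poly {poly k}}} :=
  map_poly nest1 \o @muni 1 k.
Definition nest3 : {rmorphism {mpoly k[3]} -> {poly {poly {poly k}}}} :=
  map_poly nest2 \o @muni 2 k.

Lemma nest1_inj : injective nest1.
Proof.
apply: inj_comp (@muni_inj 0 k); apply: map_inj_poly; last exact: rmorph0.
exact: can_inj (mpolyKC (R := k)).
Qed.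

Lemma nest2_inj : injective nest2.
Proof.
apply: inj_comp (@muni_inj 1 k); apply: map_inj_poly; last exact: rmorph0.
exact: nest1_inj.
Qed.

Lemma nest3_inj : injective nest3.
Proof.
apply: inj_comp (@muni_inj 2 k); apply: map_inj_poly; last exact: rmorph0.
exact: nest2_inj.
Qed.

Variables (S : comNzRingType) (iota : {rmorphism k -> S}).

Lemma evp_map_poly (R R' : nzRingType) (f : {rmorphism R -> R'})
    (g : {rmorphism R' -> S}) (g' : {rmorphism R -> S}) w p :
  g' =1 g \o f -> evp g' w p = evp g w (map_poly f p).
Proof. by move=> gE; rewrite /evp -map_poly_comp (eq_map_poly gE). Qed.

Lemma mmap_nest1 u p :
  mmap iota (fun i : 'I_1 => [:: u]`_i) p = evp iota u (nest1 p).
Proof.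
rewrite mmap_muni; apply: evp_map_poly => q /=.
by rewrite [q in LHS]nvar0_mpolyC mmapC.
Qed.

Lemma mmap_nest2 u v p : mmap iota (fun i : 'I_2 => [:: u; v]`_i) p =
  evp (evp iota u) v (nest2 p).
Proof.
rewrite mmap_muni; apply: evp_map_poly => q /=.
by rewrite -mmap_nest1; apply: eq_mmap => // i; rewrite [i]ord1.
Qed.

Lemma mmap_nest3 u v w p : mmap iota (fun i : 'I_3 => [:: u; v; w]`_i) p =
  evp (evp (evp iota u) v) w (nest3 p).
Proof.
rewrite mmap_muni; apply: evp_map_poly => q /=.
by rewrite -mmap_nest2; apply: eq_mmap => // -[[|[|i]]].
Qed.

End Dependence.

(** * Homogeneous components *)

Lemma Zgrading_opp (k : fieldType) (B : comAlgType k) (A : {pred B})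
    (G : int -> B -> Prop) :
  Zgrading A G -> Zgrading A (fun d => G (- d)).
Proof.
case=> GA Glin GM Gspan Gind; split.
- by move=> d a /GA.
- by move=> d; apply: Glin.
- by move=> d e u v Gu Gv; rewrite opprD; apply: GM.
- move=> a /Gspan[s [c [us Gc ->]]]; exists (map -%R s), (fun d => c (- d)); split.
  + by rewrite map_inj_uniq //; apply: oppr_inj.
  + by move=> d; apply: Gc.
  + by rewrite big_map; apply: eq_bigr => d _; rewrite opprK.
move=> s c us Gc s0 d ds; rewrite -[d]opprK.
apply: (Gind (map -%R s) (fun d => c (- d))); last by rewrite map_f.
- by rewrite map_inj_uniq //; apply: oppr_inj.
- by move=> d'; have := Gc (- d'); rewrite opprK.
by rewrite big_map -[RHS]s0; apply: eq_bigr => e _; rewrite opprK.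
Qed.

Section Grading.

Variables (k : fieldType) (n : nat) (h : n.-tuple {mpoly k[n]}).
Local Notation P := {mpoly k[n]}.
Local Notation phi := (comp_mpoly h).
Hypothesis idem : forall p, phi (phi p) = phi p.
Variables (A : {pred P}) (G : int -> P -> Prop).
Hypothesis AE : forall a, a \in A <-> retr h a.
Hypothesis grA : Zgrading A G.
Implicit Types (a b u v w : P) (d e l : int) (q : {poly P}).

Lemma G_retr d a : G d a -> retr h a.
Proof. by case: grA => GA _ _ _ _ /GA /AE. Qed.
Lemma G_0 d : G d 0. Proof. by case: grA => _ /(_ d)[]. Qed.
Lemma G_lin d c u v : G d u -> G d v -> G d (c *: u + v).
Proof. by case: grA => _ /(_ d)[_ +] _ _ _; apply. Qed.
Lemma G_D d u v : G d u -> G d v -> G d (u + v).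
Proof. by move=> Gu Gv; rewrite -[u]scale1r; apply: G_lin. Qed.
Lemma G_Z d c u : G d u -> G d (c *: u).
Proof. by move=> Gu; rewrite -[_ *: _]addr0; apply: G_lin => //; apply: G_0. Qed.
Lemma G_B d u v : G d u -> G d v -> G d (u - v).
Proof. by move=> Gu Gv; rewrite addrC -scaleN1r; apply: G_lin. Qed.
Lemma G_M d e u v : G d u -> G e v -> G (d + e) (u * v).
Proof. by case: grA => _ _ + _ _; apply. Qed.
Lemma G_sum d (I : Type) (r : seq I) (Q : pred I) (F : I -> P) :
  (forall i, Q i -> G d (F i)) -> G d (\sum_(i <- r | Q i) F i).
Proof.
by move=> GF; elim/big_rec: _ => [|i x /GF]; [apply: G_0|apply: G_D].
Qed.

(** The polynomial q lists the components of a from degree l on, so that products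
    and uniqueness of components become statements about polynomials. *)
Definition rep l q a := (forall i : nat, G (l + i%:Z) q`_i) /\ a = q.[1].

Lemma rep_hom d a : G d a -> rep d a%:P a.
Proof.
move=> Ga; split=> [i|]; last by rewrite hornerC.
by rewrite coefC; case: eqP => [->|_]; [rewrite addr0|apply: G_0].
Qed.

Lemma rep_shift l q a m : rep l q a -> rep (l - m%:Z) (q * 'X^m) a.
Proof.
case=> Gq ->; split=> [i|]; last by rewrite hornerM hornerXn expr1n mulr1.
rewrite coefMXn; case: ltnP => [_|le_mi]; first exact: G_0.
by have := Gq (i - m)%N; congr (G _ _); lia.
Qed.

Lemma rep_lower l l' q a : l' <= l -> rep l q a -> exists q', rep l' q' a.
Proof.
move=> le_l /(rep_shift (absz (l - l')%R))=> repq; exists (q * 'X^(absz (l - l')%R)).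
by move: repq; congr rep; lia.
Qed.

Lemma repD l q q' a b : rep l q a -> rep l q' b -> rep l (q + q') (a + b).
Proof.
move=> [Gq ->] [Gq' ->]; split; last by rewrite hornerD.
by move=> i; rewrite coefD; apply: G_D.
Qed.

Lemma repM l l' q q' a b : rep l q a -> rep l' q' b -> rep (l + l') (q * q') (a * b).
Proof.
move=> [Gq ->] [Gq' ->]; split; last by rewrite hornerM.
move=> i; rewrite coefM; apply: G_sum => j _.
have -> : l + l' + i%:Z = (l + j%:Z) + (l' + (i - j)%N%:Z).
  by have := ltn_ord j; lia.
exact: G_M.
Qed.

Lemma rep_ex a : retr h a -> exists l q, rep l q a.
Proof.
move=> /AE; case: grA => _ _ _ spanG _ /spanG[s [c [_ Gc ->]]].
elim/big_rec: _ => [|d b _ [l [q repb]]].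
  by exists 0, 0; split=> [i|]; rewrite ?horner0 // coef0; apply: G_0.
pose l' := Order.min l d.
have [q1 rep1] : exists q', rep l' q' b by apply: rep_lower repb; rewrite /l' ge_min lexx.
have [q2 rep2] : exists q', rep l' q' (c d).
  by apply: rep_lower (rep_hom (Gc d)); rewrite /l' ge_min lexx orbT.
by exists l', (q2 + q1); apply: repD.
Qed.

Lemma rep0 l q : rep l q 0 -> q = 0.
Proof.
case=> Gq q1; case: grA => _ _ _ _ indep.
pose s := [seq l + i%:Z | i <- iota 0 (size q)].
pose c d : P := if l <= d then q`_(absz (d - l)%R) else 0.
have cE i : c (l + i%:Z) = q`_i.
  by rewrite /c ifT; [congr (_`__); lia | lia].
have us : uniq s.
  by rewrite map_inj_uniq ?iota_uniq // => i j /addrI [].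
have Gc d : G d (c d).
  rewrite /c; case: ifP => [le_ld|_]; last exact: G_0.
  have := Gq (absz (d - l)%R); congr (G _ _); lia.
have s0 : \sum_(d <- s) c d = 0.
  rewrite big_map [RHS]q1 horner_coef -(big_mkord xpredT (fun i => q`_i * 1 ^+ i)).
  by rewrite /index_iota subn0; apply: eq_bigr => i _; rewrite cE expr1n mulr1.
apply/polyP => i; rewrite coef0; have [lti|/(nth_default 0)//] := ltnP i (size q).
rewrite -cE; apply: (indep s c us Gc s0).
by apply/mapP; exists i; rewrite // mem_iota.
Qed.

Lemma rep_unique l q q' a : rep l q a -> rep l q' a -> q = q'.
Proof.
move=> repq [Gq' def_a]; apply/eqP; rewrite -subr_eq0; apply/eqP/(@rep0 l).
split=> [i|]; first by rewrite coefB; apply: G_B => //; case: repq.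
by rewrite hornerD hornerN -def_a; case: repq => _ <-; rewrite subrr.
Qed.

Lemma rep_normal a : retr h a -> a != 0 -> exists l q, rep l q a /\ q`_0 != 0.
Proof.
move=> /rep_ex[l [q repq]] a0.
have q0 : q != 0 by apply: contraNneq a0 => q0; case: repq => _ ->; rewrite q0 horner0.
elim/poly_ind: q l repq q0 => [|q c IH] l repq; first by rewrite eqxx.
have [c0|c0 _] := eqVneq c 0; last first.
  exists l, (q * 'X + c%:P); split=> //.
  by rewrite coefD coefMX coefC eqxx add0r.
rewrite c0 addr0 => qX0; apply: (IH (l + 1)); last first.
  by apply: contraNneq qX0 => ->; rewrite mul0r.
case: repq => Gq def_a; split=> [i|].
  have := Gq i.+1; rewrite coefD coefMX coefC /= addr0; congr (G _ _); lia.
by rewrite def_a c0 addr0 hornerMX mulr1.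
Qed.

(** Start the components of both factors at nonzero ones.  The product of the two
    component polynomials is then a monomial with nonzero constant term, so it
    has degree zero, and so do both polynomials. *)
Lemma hom_factor d a u v : a != 0 -> G d a -> retr h u -> retr h v -> a = u * v ->
  exists e, G e u /\ G (d - e) v.
Proof.
move=> a0 Ga ru rv def_a.
have /andP[u0 v0] : (u != 0) && (v != 0) by rewrite -negb_or -mulf_eq0 -def_a.
have [l [q [repu qu0]]] := rep_normal ru u0.
have [l' [q' [repv qv0]]] := rep_normal rv v0.
have := repM repu repv; rewrite -def_a => repa.
have q00 : (q * q')`_0 != 0 by rewrite coef0M mulf_neq0.
have qa : q * q' = a%:P /\ d = l + l'.
  have [le_ld|lt_dl] := lerP (l + l') d.
    have := rep_shift (absz (d - (l + l'))%R) (rep_hom Ga).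
    have -> : d - (absz (d - (l + l'))%R)%:Z = l + l' by lia.
    move/(rep_unique repa) => qq; move: q00; rewrite qq coefMXn.
    case: (posnP (absz (d - (l + l'))%R)) => [d0 _|_]; last by rewrite eqxx.
    by rewrite d0 expr0 mulr1; split=> //; lia.
  have := rep_shift (absz (l + l' - d)%R) repa.
  have -> : l + l' - (absz (l + l' - d)%R)%:Z = d by lia.
  move/(rep_unique (rep_hom Ga))/(congr1 (fun q => q`_0)).
  rewrite coefC eqxx coefMXn; have -> : (0 < absz (l + l' - d)%R)%N by lia.
  by move=> a00; rewrite a00 eqxx in a0.
case: qa => qa def_d; have : size (q * q') = 1%N by rewrite qa size_polyC a0.
have [nq nq'] : q != 0 /\ q' != 0.
  by apply/andP; rewrite -negb_or -mulf_eq0 qa polyC_eq0.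
rewrite size_mul // => sz.
have [sq sq'] : (size q <= 1)%N /\ (size q' <= 1)%N.
  by move: nq nq' sz; rewrite -!size_poly_gt0; move: (size q) (size q') => x y; lia.
exists l; have -> : d - l = l' by rewrite def_d addrC addKr.
have [Gu ->] := repu; have [Gv ->] := repv.
rewrite (size1_polyC sq) (size1_polyC sq') !hornerC.
by have := Gu 0; have := Gv 0; rewrite !addr0.
Qed.

Lemma rep_family (I : finType) (e : I -> int) (x : I -> P) :
    injective e -> (forall i, G (e i) (x i)) ->
  exists l q, rep l q (\sum_i x i) /\
    forall i, exists j, e i = l + j%:Z /\ q`_j = x i.
Proof.
move=> e_inj Gx; pose l := - (\sum_i absz (e i))%N%:Z.
have le_l i : l <= e i.
  have : (absz (e i) <= \sum_i absz (e i))%N by rewrite (bigD1 i) //= leq_addr.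
  by rewrite /l; lia.
have eE i : e i = l + (absz (e i - l)%R)%:Z by have := le_l i; lia.
have inj' : injective (fun i => absz (e i - l)%R).
  by move=> i j eq_ij; apply: e_inj; rewrite eE eq_ij -eE.
pose q := \sum_i (x i)%:P * 'X^(absz (e i - l)%R).
have qE i : q`_(absz (e i - l)%R) = x i.
  rewrite coef_sum (bigD1 i) //= coefCM coefXn eqxx mulr1 big1 ?addr0 // => j ne_ji.
  by rewrite coefCM coefXn (inj_eq inj') eq_sym (negbTE ne_ji) mulr0.
exists l, q; split; last by move=> i; exists (absz (e i - l)%R).
split=> [j|]; last first.
  by rewrite horner_sum; apply: eq_bigr => i _; rewrite hornerCM hornerXn expr1n mulr1.
rewrite coef_sum; apply: G_sum => i _; rewrite coefCM coefXn.
have [->|_] := eqVneq; last by rewrite mulr0; apply: G_0.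
by rewrite mulr1 -eE.
Qed.

Lemma homog_sum0 (I : finType) (e : I -> int) (x : I -> P) :
    injective e -> (forall i, G (e i) (x i)) -> \sum_i x i = 0 ->
  forall i, x i = 0.
Proof.
move=> e_inj Gx; have [l [q [repq qE]]] := rep_family e_inj Gx.
move=> s0 i; have [j [_ <-]] := qE i; rewrite s0 in repq.
by rewrite (rep0 repq) coef0.
Qed.

(** The ideal generated by a homogeneous element contains the components of its
    elements. *)
Lemma homog_sum_divides d p w (I : finType) (e : I -> int) (x : I -> P) :
    injective e -> (forall i, G (e i) (x i)) -> G d p -> retr h w ->
    \sum_i x i = p * w -> forall i, divides p (x i).
Proof.
move=> e_inj Gx Gp rw; have [l [q [repq qE]]] := rep_family e_inj Gx.
move=> def_s i; have [j [_ <-]] := qE i.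
have [l' [q' repw]] := rep_ex rw.
have := repM (rep_hom Gp) repw; rewrite -def_s => reps.
have divpq m r : q * 'X^m = p%:P * r -> divides p q`_j.
  move/(congr1 (fun s : {poly P} => s`_(j + m))); rewrite coefMXn ltnNge leq_addl /= addnK coefCM => ->.
  by exists r`_(j + m).
have [le_l|lt_l] := lerP l (d + l').
  have := rep_shift (absz (d + l' - l)%R) reps.
  have -> : d + l' - (absz (d + l' - l)%R)%:Z = l by lia.
  move/(rep_unique repq) => qq; apply: (divpq 0 (q' * 'X^(absz (d + l' - l)%R))).
  by rewrite expr0 mulr1 qq mulrA.
have := rep_shift (absz (l - (d + l'))%R) repq.
have -> : l - (absz (l - (d + l'))%R)%:Z = d + l' by lia.
by move/rep_unique/(_ reps); apply: divpq.
Qed.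

Lemma deg_unique d e a : a != 0 -> G d a -> G e a -> d = e.
Proof.
move=> a0 Gd Ge; apply: NNPP => /eqP ne_de.
have := @homog_sum0 bool (fun t => if t then d else e) (fun t => if t then a else - a).
move=> H; case/eqP: a0; apply: (H _ _ _ true).
- by move=> [] [] //= ed; case/eqP: ne_de.
- by case=> //; rewrite -scaleN1r; apply: G_Z.
- by rewrite big_bool /= subrr.
Qed.

(** Apply [hom_factor] to a = 1 * a for a nonzero homogeneous a. *)
Lemma G_1 : G 0 1.
Proof.
have [l [q [[Gq def1] q0]]] := rep_normal (retrC h 1) (oner_neq0 _).
have r1 : retr h 1 by apply: retrC.
have [e [Ge Gde]] := hom_factor q0 (Gq 0) r1 (G_retr (Gq 0)) (esym (mul1r _)).
have := deg_unique q0 (Gq 0) Gde => eqd; suff <- : e = 0 by [].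
lia.
Qed.

Lemma G_C c : G 0 c%:MP.
Proof. by rewrite -[_%:MP]mulr1 mul_mpolyC; apply/G_Z/G_1. Qed.

Lemma G_X d a i : G d a -> G (d * i%:Z) (a ^+ i).
Proof.
move=> Ga; elim: i => [|i IH]; first by rewrite mulr0; apply: G_1.
rewrite exprS; have -> : d * i.+1%:Z = d + d * i%:Z by lia.
exact: G_M.
Qed.

Lemma nontrivial_degree : ~ (forall a, G 0 a <-> a \in A) ->
  exists d a, [/\ d != 0, a != 0 & G d a].
Proof.
move=> ntriv; apply: NNPP => none; apply: ntriv => a.
split=> [/G_retr/AE //|/AE/rep_ex[l [q [Gq ->]]]].
rewrite horner_coef; apply: G_sum => i _; rewrite expr1n mulr1.
have [->|qi0] := eqVneq q`_i 0; first exact: G_0.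
have [<-|ne0] := eqVneq (l + i%:Z) 0; first exact: Gq.
by case: none; exists (l + i%:Z), q`_i.
Qed.

Lemma homogeneous_generate (T : P -> Prop) : T 0 ->
    (forall a b, T a -> T b -> T (a + b)) ->
    (forall d a, a != 0 -> G d a -> T a) -> forall a, retr h a -> T a.
Proof.
move=> T0 TD TG a /rep_ex[l [q [Gq ->]]]; rewrite horner_coef.
elim/big_rec: _ => [//|i x _ Tx]; apply: (TD) => //; rewrite expr1n mulr1.
by have [->//|q0] := eqVneq q`_i 0; apply: TG (Gq i).
Qed.

Definition hom_prime d p := retr_prime h p /\ G d p.

Lemma hom_factorization d a : a != 0 -> G d a -> exists (c : k) ps,
  [/\ c != 0, forall p, p \in ps -> exists e, hom_prime e p
    & a = c *: \prod_(p <- ps) p].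
Proof.
move=> a0 Ga; have [c [ps [c0 pps def_a]]] := retr_factorization idem (G_retr Ga) a0.
exists c, ps; split=> // p /[dup] psp /pps pp; suff [e Gp] : exists e, G e p by exists e.
have rp : retr h p by case: pp.
have : a = p * (c *: \prod_(q <- rem p ps) q).
  by rewrite def_a (big_rem _ psp) /= scalerAr.
case/(hom_factor a0 Ga rp); last by move=> e []; exists e.
apply: retrZ; rewrite big_seq; elim/big_rec: _ => [|q x /mem_rem/pps[rq _ _]].
  exact: (retrC h 1).
exact: retrM.
Qed.

End Grading.

(** * Linear parts at a point *)

Lemma mpoly_alg_ind (R : comNzRingType) n (Q : {mpoly R[n]} -> Prop) :
    (forall c, Q c%:MP) -> (forall i, Q 'X_i) ->
    (forall p q, Q p -> Q q -> Q (p + q)) -> (forall p q, Q p -> Q q -> Q (p * q)) ->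
  forall p, Q p.
Proof.
move=> QC QX QD QM p; elim/mpolyind: p => [|c m p _ _ Qp]; first by rewrite -mpolyC0.
apply: (QD) => //; rewrite -mul_mpolyC; apply: (QM) => //.
rewrite mpolyXE_id; elim/big_rec: _ => [|i x _ Qx]; first by rewrite -mpolyC1.
apply: (QM) => //; elim: (m i) => [|e IH]; first by rewrite expr0 -mpolyC1.
by rewrite exprS; apply: (QM).
Qed.

Lemma vanishing_mpoly (k : closedFieldType) n (p : {mpoly k[n]}) :
  (forall v, p.@[v] = 0) -> p = 0.
Proof.
elim: n p => [|n IH] p p_vanish.
  have := p_vanish (fun _ => 0); rewrite [p]nvar0_mpolyC mevalC => ->.
  exact: mpolyC0.
apply: (@muni_inj n k); rewrite muni0; apply/polyP => i; rewrite coef0.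
apply: IH => v; pose q := map_poly (meval v) (muni p).
suff q0 : q = 0 by have := congr1 (fun r : {poly k} => r`_i) q0; rewrite coef_map coef0.
apply/eqP; apply/negPn/negP => /closed_nonrootP[x].
pose v' (i : 'I_n.+1) := if insub (val i) is Some j then v j else x.
have := p_vanish v'; rewrite /meval mmap_muni /v' insubN /= ?ltnn // => px0.
case/negP; apply/rootP; rewrite -[RHS]px0; congr (_.[_]); apply: eq_map_poly => r.
by rewrite /meval; apply: eq_mmap => // j; rewrite /= valK.
Qed.

Section LinearPart.

Variables (k : fieldType) (n : nat) (c : 'I_n -> k).

Definition linear_part (b : {mpoly k[n]}) : 'rV[k]_n := \row_j (b^`M(j)).@[c].

Lemma linear_partC a : linear_part a%:MP = 0.
Proof. by apply/rowP => j; rewrite !mxE mderivC meval0. Qed.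

Lemma linear_partX i : linear_part 'X_i = delta_mx 0 i.
Proof.
apply/rowP => j; rewrite !mxE mderivX mnm1E eqxx /=; have [->|ne] := eqVneq i j.
  by rewrite scale1r (_ : (U_(j) - U_(j))%MM = 0%MM) ?mpolyX0 ?meval1 //; apply/mnmP => l; rewrite mnmBE subnn mnm0E.
by rewrite scale0r meval0.
Qed.

Lemma linear_partD b b' : linear_part (b + b') = linear_part b + linear_part b'.
Proof. by apply/rowP => j; rewrite !mxE mderivD mevalD. Qed.

Lemma linear_partM b b' :
  linear_part (b * b') = b'.@[c] *: linear_part b + b.@[c] *: linear_part b'.
Proof. by apply/rowP => j; rewrite !mxE mderivM mevalD !mevalM mulrC. Qed.

(** Restriction to the line through c with direction v. *)
Definition line (v : 'rV[k]_n) : {rmorphism {mpoly k[n]} -> {poly k}} :=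
  mmap polyC (fun i => (c i)%:P + v 0 i *: 'X).

Lemma lineC v a : line v a%:MP = a%:P. Proof. exact: mmapC. Qed.

Lemma line_coef v b :
  (line v b)`_0 = b.@[c] /\ (line v b)`_1 = (linear_part b *m v^T) 0 0.
Proof.
elim/mpoly_alg_ind: b => [a|i|b b' [b0 b1] [b'0 b'1]|b b' [b0 b1] [b'0 b'1]].
- by rewrite lineC linear_partC mevalC mul0mx mxE !coefC.
- rewrite linear_partX -rowE !mxE mevalXU /line /= mmapX mmap1U.
  by rewrite !coefD !coefC !coefZ !coefX mulr0 mulr1 addr0 add0r.
- by rewrite rmorphD linear_partD mevalD mulmxDl !coefD mxE b0 b1 b'0 b'1.
rewrite rmorphM linear_partM mevalM mulmxDl -!scalemxAl !coefM !big_ord_recr big_ord0 /=.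
rewrite /line /= in b0 b1 b'0 b'1 *.
rewrite ?big_ord0 ?add0r subnn subn0 b0 b1 b'0 b'1; split=> //.
by rewrite [RHS]mxE [X in _ = X + _]mxE [X in _ = _ + X]mxE addrC [X in X + _]mulrC.
Qed.

End LinearPart.

(** * The case of a connected positive grading *)

Lemma polyX_factor (R : nzRingType) (p : {poly R}) : p`_0 = 0 ->
  exists q, p = q * 'X /\ q`_0 = p`_1.
Proof.
move=> p0; exists (\poly_(i < size p) p`_i.+1); split; last first.
  rewrite coef_poly; case: ltnP => // sp; by rewrite nth_default // (leq_trans sp).
apply/polyP => [[|i]]; rewrite coefMX //= coef_poly; case: ltnP => // sp.
by rewrite nth_default // (leq_trans sp).
Qed.

(** Restrict a relation Q between the Y_i to a line through c.  The Y_i become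
    multiples T g_i of the parameter, and the g_i 0 take arbitrary values tau_i as
    the direction of the line varies.  The coefficient of T^e, for e the lowest
    degree in Q, shows that the lowest form of Q vanishes at every tau. *)
Lemma independent_linear_parts (k : closedFieldType) n (c : 'I_n -> k) r
    (Y : 'I_r -> {mpoly k[n]}) :
    (forall i, (Y i).@[c] = 0) ->
    row_free (\matrix_i linear_part c (Y i)) ->
  forall Q, mmap (@mpolyC n k) Y Q = 0 -> Q = 0.
Proof.
move=> Yc0 /row_freeP[B MB] Q QY0; apply/eqP/negPn/negP => Q0.
have [|m0 [m0Q m0min]] := @exists_minimal _ (@mdeg r) (fun m => m \in msupp Q).
  by exists (mlead Q); apply: mlead_supp.
pose e := mdeg m0; pose Qe := \sum_(m <- msupp Q | mdeg m == e) Q@_m *: 'X_[m].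
suff Qe0 : Qe = 0.
  move: (m0Q); rewrite mcoeff_msupp => /eqP[]; transitivity (Qe@_m0); last by rewrite Qe0 mcoeff0.
  rewrite raddf_sum /= big_mkcond (bigD1_seq m0) ?msupp_uniq //= eqxx.
  rewrite mcoeffZ mcoeffX eqxx mulr1 big1 ?addr0 // => m ne; case: ifP => // _.
  by rewrite mcoeffZ mcoeffX (negbTE ne) mulr0.
apply: vanishing_mpoly => tau.
pose v : 'rV[k]_n := (B *m (\col_i tau i))^T.
have Yv i : exists g : {poly k}, line c v (Y i) = g * 'X /\ g`_0 = tau i.
  have [Y0 Y1] := line_coef c v (Y i).
  have [|g [def_g gY]] := @polyX_factor _ (line c v (Y i)); first by rewrite Y0.
  exists g; split=> //; rewrite gY Y1 /v trmxK.
  have -> : linear_part c (Y i) = row i (\matrix_i linear_part c (Y i)) by rewrite rowK.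
  by rewrite -row_mul mulmxA MB mul1mx !mxE.
have [g gP] := fin_all_exists Yv.
have term m : line c v ((Q@_m)%:MP * mmap1 Y m) =
    (Q@_m)%:P * (\prod_i g i ^+ m i) * 'X^(mdeg m).
  rewrite rmorphM /= lineC -mulrA; congr (_ * _); rewrite rmorph_prod mdegE.
  rewrite -prodrXr -big_split; apply: eq_bigr => i _ /=.
  by rewrite rmorphXn -exprMn; have [<- _] := gP i.
have := congr1 (fun p => (line c v p)`_e) QY0.
rewrite /mmap rmorph_sum rmorph0 coef0 coef_sum => sum0.
rewrite -[RHS]sum0 /Qe raddf_sum /= [RHS](bigID (fun m => mdeg m == e)) /=.
rewrite [X in _ = _ + X]big1_seq ?addr0; last first.
  move=> m /andP[ne mQ]; rewrite -/(line c v _) term coefMXn ifT //.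
  by rewrite ltn_neqAle eq_sym ne m0min.
apply: eq_bigr => m /eqP mE; rewrite mevalZ mevalX.
rewrite -/(line c v _) term coefMXn mE ltnn subnn coefCM; congr (_ * _).
rewrite -horner_coef0 horner_prod; apply: eq_bigr => i _.
by rewrite horner_exp horner_coef0; have [_ ->] := gP i.
Qed.

Lemma maximal_independent_rows (k : fieldType) (T : Type) n (f : T -> 'rV[k]_n) :
  exists r (Y : 'I_r -> T), row_free (\matrix_i f (Y i)) /\
    forall a, (f a <= \matrix_i f (Y i))%MS.
Proof.
pose good r := exists Y : 'I_r -> T, row_free (\matrix_i f (Y i)).
have good0 : good 0.
  by exists (fun i : 'I_0 => False_rect T (notF (ltn_ord i))); rewrite /row_free flatmx0 mxrank0.
have [|r [[Y freeY] maxr]] := @exists_minimal _ (fun r => n - r)%N good; first by exists 0.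
exists r, Y; split=> // a; apply: NNPP => /negP naY.
pose Y' (i : 'I_(r + 1)) := match split i with inl j => Y j | inr _ => a end.
have defY' : \matrix_i f (Y' i) = col_mx (\matrix_i f (Y i)) (f a).
  apply/row_matrixP => i; rewrite rowK /Y'; case: splitP => j ij.
    have -> : i = lshift 1 j by apply/val_inj.
    by rewrite rowKu rowK.
  have -> : i = rshift r j by apply/val_inj.
  by rewrite rowKd [j]ord1 row_id.
have freeY' : row_free (\matrix_i f (Y' i)).
  rewrite defY'; apply: inj_row_free => u; rewrite -[u]hsubmxK mul_row_col.
  set u1 := lsubmx u; set u2 := rsubmx u => uY0.
  have [u20|nz] := eqVneq (u2 0 0) 0.
    have u2E : u2 = 0 by apply/rowP => i; rewrite [i]ord1 u20 mxE.
    move: uY0; rewrite u2E mul0mx addr0 => /eqP; rewrite -(mul0mx _ (\matrix_i f (Y i))).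
    by move/eqP/(row_free_inj freeY) ->; rewrite row_mx0.
  pose z := u2 0 0; have u2E : u2 = z%:M by rewrite [u2 in LHS]mx11_scalar.
  rewrite -/z in nz; rewrite u2E mul_scalar_mx in uY0.
  case/negP: naY; have -> : f a = (- z^-1 *: u1) *m \matrix_i f (Y i).
    rewrite -scalemxAl; move/eqP: uY0; rewrite addr_eq0 => /eqP ->.
    by rewrite scalerN scaleNr opprK scalerA mulVf // scale1r.
  exact: submxMl.
have ltrn : (r + 1 <= n)%N by rewrite -(eqP freeY') rank_leq_col.
by have := maxr _ (ex_intro _ Y' freeY'); lia.
Qed.

Section PositiveGrading.

Variables (k : closedFieldType) (n : nat) (h : n.-tuple {mpoly k[n]}).
Local Notation P := {mpoly k[n]}.
Local Notation phi := (comp_mpoly h).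
Hypothesis idem : forall p, phi (phi p) = phi p.
Variables (A : {pred P}) (G : int -> P -> Prop).
Hypothesis AE : forall a, a \in A <-> retr h a.
Hypothesis grA : Zgrading A G.
Hypothesis G_ge0 : forall d a, a != 0 -> G d a -> 0 <= d.
Hypothesis G_const : forall a, G 0 a -> is_const a.
Implicit Types (a b u v w : P) (d e l : int) (q : {poly P}).

Local Notation rep := (rep G).

(** This is the ideal A_+ of the grading. *)
Definition Aplus a := exists q, rep 1 q a.

Lemma AplusD a b : Aplus a -> Aplus b -> Aplus (a + b).
Proof. by move=> [q ra] [q' rb]; exists (q + q'); apply: (repD grA). Qed.

Lemma Aplus_hom d a : 0 < d -> G d a -> Aplus a.
Proof. by move=> d0 /(rep_hom grA); apply: (rep_lower grA); lia. Qed.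

Lemma Aplus0 : Aplus 0.
Proof. exact: Aplus_hom (G_0 grA 1). Qed.

Lemma AplusZ c a : Aplus a -> Aplus (c *: a).
Proof.
case=> q [Gq ->]; exists ((c%:MP)%:P * q); split=> [i|].
  by rewrite coefCM mul_mpolyC; apply: (G_Z grA).
by rewrite hornerCM mul_mpolyC.
Qed.

Lemma AplusM a b : Aplus a -> Aplus b -> Aplus (a * b).
Proof.
by move=> [q ra] [q' rb]; apply: (rep_lower grA _ (repM grA ra rb)).
Qed.

Lemma Aplus_const c : Aplus c%:MP -> c = 0.
Proof.
case=> q /(rep_shift grA 1); rewrite subrr => rc.
have /(rep_unique grA rc) := rep_hom grA (G_C AE grA c).
move/(congr1 (fun s : {poly P} => s`_0)); rewrite coefMXn coefC /= => c0.
by apply/eqP; rewrite -(mpolyC_eq0 n) -c0.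
Qed.

Lemma const_split a : retr h a -> exists c, Aplus (a - c%:MP).
Proof.
case/(rep_ex AE grA) => l [q [Gq ->]]; rewrite horner_coef.
elim/big_rec: _ => [|i x _ [c Ax]]; first by exists 0; rewrite mpolyC0 subrr; apply: Aplus0.
rewrite expr1n mulr1; have := Gq i; move: q`_i (l + i%:Z) => u d Gu.
have [u0|u0] := eqVneq u 0; first by exists c; rewrite u0 add0r.
have := G_ge0 u0 Gu; rewrite le_eqVlt => /predU1P[d0|d0].
  move: Gu; rewrite -d0 => /G_const/is_constP[c' ->]; exists (c' + c).
  by rewrite mpolyCD opprD addrACA subrr add0r.
by exists c; rewrite -addrA; apply: AplusD => //; apply: Aplus_hom Gu.
Qed.

(** The square of the ideal of elements of positive degree. *)
Inductive Asquare : P -> Prop :=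
| Asquare0 : Asquare 0
| AsquareMD u v w : Aplus u -> Aplus v -> Asquare w -> Asquare (u * v + w).

Lemma Asquare_mul u v : Aplus u -> Aplus v -> Asquare (u * v).
Proof. by move=> Au Av; rewrite -[_ * _]addr0; apply: AsquareMD => //; apply: Asquare0. Qed.

Lemma AsquareD a b : Asquare a -> Asquare b -> Asquare (a + b).
Proof.
move=> Sa Sb; elim: Sa => [|u v w Au Av _ IH]; first by rewrite add0r.
by rewrite -addrA; apply: AsquareMD.
Qed.

Lemma AsquareZ c a : Asquare a -> Asquare (c *: a).
Proof.
elim=> [|u v w Au Av _ IH]; first by rewrite scaler0; apply: Asquare0.
by rewrite scalerDr scalerAl; apply: AsquareMD => //; apply: AplusZ.
Qed.

Lemma Asquare_plus a : Asquare a -> Aplus a.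
Proof.
by elim=> [|u v w Au Av _ IH]; [apply: Aplus0|apply: AplusD => //; apply: AplusM].
Qed.

Section Taylor.

Variable c : 'I_n -> k.
Hypothesis cP : forall i, Aplus (tnth h i - (c i)%:MP).
Local Notation m := (fun i => tnth h i - (c i)%:MP).

(** The differential of b at c, applied to the images m_j under phi of the
    coordinates centred at c. *)
Definition first_order b := \sum_j linear_part c b 0 j *: m j.

Lemma first_order_plus b : Aplus (first_order b).
Proof.
by rewrite /first_order; elim/big_rec: _ => [|j x _]; [apply: Aplus0|apply: AplusD; apply: AplusZ].
Qed.

(** Taylor expansion of phi b = b (c + m), where the m_j lie in A_+. *)
Lemma taylor b : exists2 s, Asquare s & phi b = (b.@[c])%:MP + first_order b + s.
Proof.
rewrite /first_order; elim/mpoly_alg_ind: b => [a|i|b b' [s Ss E] [s' Ss' E']|b b' [s Ss E] [s' Ss' E']].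
- exists 0; first exact: Asquare0.
  by rewrite mevalC linear_partC comp_mpolyC big1 ?addr0 // => j _; rewrite mxE scale0r.
- exists 0; first exact: Asquare0.
  rewrite comp_mpolyXU -tnth_nth mevalXU linear_partX (bigD1 i) //= big1 => [|j ne].
    by rewrite mxE !eqxx scale1r !addr0 addrC subrK.
  by rewrite mxE (negbTE ne) scale0r.
- exists (s + s'); first exact: AsquareD.
  rewrite rmorphD /= E E' mevalD mpolyCD linear_partD.
  under [in RHS]eq_bigr => j _ do rewrite mxE scalerDl.
  by rewrite big_split /=; ring.
have L := first_order_plus b; have L' := first_order_plus b'.
exists (first_order b * first_order b' + (first_order b * s' + (s * first_order b' +
  (s * s' + (b.@[c] *: s' + b'.@[c] *: s))))).
  by do 4![apply: AsquareD; first by apply: Asquare_mul => //; apply: Asquare_plus];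
     apply: AsquareD; apply: AsquareZ.
rewrite rmorphM /= E E' mevalM mpolyCM linear_partM -/(first_order b) -/(first_order b').
under [in RHS]eq_bigr => j _ do
  rewrite mxE [X in X + _]mxE [X in _ + X]mxE scalerDl -!scalerA.
rewrite big_split /= -!scaler_sumr -/(first_order b) -/(first_order b') -!mul_mpolyC.
by ring.
Qed.

(** The constant a(c) is the component of degree zero of phi a = a. *)
Lemma meval_hom d a : 0 < d -> G d a -> a.@[c] = 0.
Proof.
move=> d0 Ga; apply: Aplus_const; have [s Ss E] := taylor a.
have -> : (a.@[c])%:MP = a + ((-1) *: first_order a + (-1) *: s).
  by rewrite -{2}(G_retr AE grA Ga) E !scaleN1r; ring.
apply: AplusD; first exact: Aplus_hom Ga.
by apply: AplusD; apply: AplusZ; [apply: first_order_plus|apply: Asquare_plus].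
Qed.

(** The components in degree at most d of a product of two elements of positive
    degree only involve their components in degree less than d: this drives the
    induction on the degree below. *)
Lemma Asquare_components (T : P -> Prop) d s : T 0 ->
    (forall a b, T a -> T b -> T (a + b)) -> (forall a b, T a -> T b -> T (a * b)) ->
    (forall e a, 0 < e -> e < d -> G e a -> T a) -> Asquare s ->
  exists q, rep 1 q s /\ forall i : nat, 1 + i%:Z <= d -> T q`_i.
Proof.
move=> T0 TD TM Tlow; elim=> [|u v w [q ru] [q' rv] _ [q'' [rw Tw]]].
  exists 0; split=> [|i _]; last by rewrite coef0.
  by split=> [i|]; rewrite ?coef0 ?horner0 //; apply: (G_0 grA).
exists (q * q' * 'X^1 + q''); split=> [|i le_id].
  apply: (repD grA) rw; have := rep_shift grA 1 (repM grA ru rv).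
  by congr (rep _ _ _); lia.
rewrite coefD; apply: (TD); last exact: Tw.
rewrite coefMXn; case: ltnP => // lt0i; rewrite coefM.
elim/big_rec: _ => // j x _; apply: (TD); apply: (TM).
  by apply: (Tlow (1 + j%:Z)); [lia|have := ltn_ord j; lia|case: ru].
by apply: (Tlow (1 + (i - 1 - j)%N%:Z)); [lia|have := ltn_ord j; lia|case: rv].
Qed.

End Taylor.

(** The y_i with linear parts forming a basis generate: if a is homogeneous of
    degree d, subtract the combination of the y_i with the same linear part.  By
    Taylor's formula the difference lies in the square of A_+, so its component
    of degree d is a polynomial in elements of smaller degree. *)
Theorem positive_grading_polynomial : exists r (Y : 'I_r -> P),
  [/\ forall i, retr h (Y i),
      forall a, retr h a -> exists p, a = mmap (@mpolyC n k) Y p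
    & forall Q, mmap (@mpolyC n k) Y Q = 0 -> Q = 0].
Proof.
have [c cP] : exists c : 'I_n -> k, forall i, Aplus (tnth h i - (c i)%:MP).
  have Hc i : exists x : k, Aplus (tnth h i - x%:MP).
    apply: const_split; rewrite (tnth_nth 0) -comp_mpolyXU; exact: retr_phi.
  by have [c cP] := fin_all_exists Hc; exists c.
pose pos a := exists2 d, 0 < d & G d a.
have [r [Y' [freeY spanY]]] :=
  maximal_independent_rows (fun a : {a | pos a} => linear_part c (sval a)).
pose Y i := sval (Y' i); have Ypos i : pos (Y i) := svalP (Y' i).
have rY i : retr h (Y i) by have [d _ /(G_retr AE grA)] := Ypos i.
pose T a := exists p, a = mmap (@mpolyC n k) Y p.
have TC (x : k) : T x%:MP by exists x%:MP; rewrite mmapC.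
have TY i : T (Y i) by exists 'X_i; rewrite mmapX mmap1U.
have TD a b : T a -> T b -> T (a + b) by move=> [p ->] [q ->]; exists (p + q); rewrite rmorphD.
have TM a b : T a -> T b -> T (a * b) by move=> [p ->] [q ->]; exists (p * q); rewrite rmorphM.
have T0 : T 0 by rewrite -mpolyC0.
have TG : forall N : nat, forall d a, (0 < d) -> d <= N%:Z -> G d a -> T a.
  elim=> [|N IH] d a d0 leN Ga; first lia.
  have /submxP[u def_u] : (linear_part c a <= \matrix_i linear_part c (Y i))%MS.
    have pa : pos a by exists d.
    exact: (spanY (exist _ a pa)).
  have [s Ss Ea] := taylor cP a.
  have [s_ sP] : exists s_ : 'I_r -> P, forall i, Asquare (s_ i) /\
      Y i = first_order c (Y i) + s_ i.
    have Hs i : exists s, Asquare s /\ Y i = first_order c (Y i) + s.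
      have [s' Ss' EY] := taylor cP (Y i); exists s'; split=> //.
      have [d' d'0 GY] := Ypos i.
      by rewrite -{1}(rY i) EY (meval_hom cP d'0 GY) mpolyC0 add0r.
    by have [s_ sP] := fin_all_exists Hs; exists s_.
  (* the first-order terms of a and of the combination of the Y i cancel *)
  have [s' [Ss' def_a]] : exists s', Asquare s' /\ a = \sum_i u 0 i *: Y i + s'.
    exists (s - \sum_i u 0 i *: s_ i); split.
      apply: AsquareD => //; rewrite -scaleN1r; apply: AsquareZ.
      elim/big_rec: _ => [|i x _]; [exact: Asquare0|apply: AsquareD; apply: AsquareZ].
      by case: (sP i).
    rewrite -{1}(G_retr AE grA Ga) Ea (meval_hom cP d0 Ga) mpolyC0 add0r.
    have -> : \sum_i u 0 i *: Y i = first_order c a + \sum_i u 0 i *: s_ i.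
      rewrite /first_order def_u.
      under [X in _ = X + _]eq_bigr => j _ do rewrite mxE scaler_suml.
      rewrite exchange_big -big_split; apply: eq_bigr => i _ /=.
      have [_ {1}->] := sP i; rewrite scalerDr; congr (_ + _); rewrite scaler_sumr.
      by apply: eq_bigr => j _; rewrite scalerA !mxE.
    by ring.
  have [|q [rq Tq]] := @Asquare_components T d s' T0 TD TM _ Ss'.
    by move=> e b e0 ltb; apply: IH => //; lia.
  have [q' [rq' Tq']] : exists q', rep 1 q' (\sum_i u 0 i *: Y i) /\ forall i, T q'`_i.
    elim/big_rec: _ => [|i x _ [q' [rx Tx]]].
      exists 0; split=> [|i]; last by rewrite coef0.
      by split=> [i|]; rewrite ?coef0 ?horner0 //; apply: (G_0 grA).
    have [e e0 GY] := Ypos i.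
    exists ((u 0 i *: Y i)%:P * 'X^(absz (e - 1)%R) + q'); split=> [|j].
      apply: (repD grA) rx.
      have := rep_shift grA (absz (e - 1)%R) (rep_hom grA (G_Z grA (u 0 i) GY)).
      by congr (rep _ _ _); lia.
    rewrite coefD; apply: (TD) => //; rewrite coefMXn; case: ifP => // _.
    by rewrite coefC; case: ifP => // _; rewrite -mul_mpolyC; apply: (TM).
  have := repD grA rq' rq; rewrite -def_a => ra.
  have := rep_shift grA (absz (d - 1)%R) (rep_hom grA Ga).
  have -> : d - (absz (d - 1)%R)%:Z = 1 by lia.
  move/(rep_unique grA ra)/(congr1 (fun s : {poly P} => s`_(absz (d - 1)%R))).
  rewrite coefMXn ltnn subnn coefC eqxx coefD => <-.
  by apply: (TD) => //; apply: Tq; lia.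
exists r, Y; split=> // [a|]; last first.
  apply: (independent_linear_parts (c := c)); last exact: freeY.
  by move=> i; have [d d0 GY] := Ypos i; apply: meval_hom GY.
move: a; apply: (homogeneous_generate AE grA (T := T)) => // d a a0 Ga.
have := G_ge0 a0 Ga; rewrite le_eqVlt => /predU1P[d0|d0].
  by move: Ga; rewrite -d0 => /G_const/is_constP[x ->]; apply: TC.
by apply: (TG (absz d) d) => //; lia.
Qed.

End PositiveGrading.

(** * Lueroth's theorem for subalgebras of k[t] *)

Lemma size_sub_lt (R : nzRingType) (F G : {poly R}) : F != 0 -> size F = size G ->
  lead_coef F = lead_coef G -> (size (F - G)%R < size F)%N.
Proof.
move=> F0 sFG lFG; rewrite -[ltnRHS]prednK ?size_poly_gt0 // ltnS.
apply/leq_sizeP => j le_j; rewrite coefB.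
have := le_j; rewrite leq_eqVlt => /predU1P[<-|lt_j].
  by rewrite {2}sFG -!lead_coefE lFG subrr.
have le_sj : (size F <= j)%N by move: lt_j; case: (size F).
by rewrite !nth_default ?subrr // -sFG.
Qed.

(** Here S is a subalgebra of k[t] containing a nonconstant f and every polynomial
    that is a quotient of two of its elements.  In {poly {poly k}} the inner
    variable is t, and the outer one, written X below, is the one in which
    relations satisfied by t are expressed: evaluation at 'X : {poly k} is
    evaluation at t. *)
Section SubalgebrasOfUnivariatePolynomials.

Variables (k : closedFieldType) (S : {poly k} -> Prop) (f : {poly k}).
Hypothesis S_C : forall c, S c%:P.
Hypothesis S_D : forall u v, S u -> S v -> S (u + v).
Hypothesis S_M : forall u v, S u -> S v -> S (u * v).
Hypothesis S_div : forall u v w, S u -> S v -> v != 0 -> u = v * w -> S w.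
Hypothesis S_f : S f.
Hypothesis f_nonconst : (1 < size f)%N.
Local Notation P2 := {poly {poly k}}.
Implicit Types (u v w s : {poly k}) (D E Q : P2).

Let S_0 : S 0. Proof. by rewrite -polyC0; apply: S_C. Qed.

Let S_N u : S u -> S (- u).
Proof. by move=> Su; rewrite -mulN1r -polyC1 -polyCN; apply: S_M. Qed.

Definition SX Q := forall i, S Q`_i.

Lemma SX_D D E : SX D -> SX E -> SX (D + E).
Proof. by move=> SD SE i; rewrite coefD; apply: S_D. Qed.

Lemma SX_M D E : SX D -> SX E -> SX (D * E).
Proof.
move=> SD SE i; rewrite coefM; elim/big_rec: _ => // j x _ Sx.
by apply: S_D => //; apply: S_M.
Qed.

Lemma SX_C u : S u -> SX u%:P.
Proof. by move=> Su i; rewrite coefC; case: ifP. Qed.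

Lemma SX_map u : SX (map_poly polyC u).
Proof. by move=> i; rewrite coef_map; apply: S_C. Qed.

Lemma SX_N D : SX D -> SX (- D).
Proof. by move=> SD i; rewrite coefN; apply: S_N. Qed.

Lemma SX_Xn i : SX 'X^i.
Proof. by move=> j; rewrite coefXn; case: eqP => _ //=; rewrite mulr1n -polyC1. Qed.

Lemma SX_pseudo_division D E : D != 0 -> SX D -> SX E -> exists N Q R,
  [/\ SX Q, SX R, (lead_coef D ^+ N)%:P * E = Q * D + R & (size R < size D)%N].
Proof.
move=> D0 SD; have [l] := ubnP (size E); elim: l => // l IH in E * => le_l SE.
have [ltED|leDE] := ltnP (size E) (size D).
  exists 0, 0, E; rewrite expr0 mul1r mul0r add0r; split=> //; exact: SX_C.
pose d := (size E - size D)%N.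
pose E' := (lead_coef D)%:P * E - (lead_coef E)%:P * D * 'X^d.
have SE' : SX E'.
  apply: SX_D; first by apply: SX_M => //; apply/SX_C/SD.
  by apply/SX_N/SX_M/SX_Xn/SX_M/SD/SX_C/SE.
have E0 : E != 0 by rewrite -size_poly_gt0 (leq_trans _ leDE) // size_poly_gt0.
have [lD lE] : lead_coef D != 0 /\ lead_coef E != 0 by rewrite !lead_coef_eq0.
have sizeE : size ((lead_coef D)%:P * E) = size E by rewrite mul_polyC size_scale.
have ltE' : (size E' < size E)%N.
  rewrite -sizeE; apply: size_sub_lt; rewrite ?mulf_neq0 ?polyC_eq0 //.
    by rewrite sizeE size_mulXn ?mulf_neq0 ?polyC_eq0 // mul_polyC size_scale // subnK.
  by rewrite !lead_coefM !lead_coefC lead_coefXn mulr1 mulrC.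
have [|N [Q [R [SQ SR eqR sR]]]] := IH E' _ SE'; first by apply: leq_trans ltE' _.
exists N.+1, (Q + (lead_coef D ^+ N * lead_coef E)%:P * 'X^d), R; split=> //.
  apply: SX_D => //; apply: SX_M (SX_Xn _); apply: SX_C; apply: S_M; last exact: SE.
  by elim: (N) => [|N' IHN]; rewrite ?expr0 -?polyC1 // exprS; apply: S_M => //; apply: SD.
rewrite mulrDl addrAC -eqR /E' exprSr !polyCM; ring.
Qed.

Lemma evalX_map u : (map_poly polyC u).['X] = u.
Proof. exact: comp_polyXr. Qed.

(** This is u(X) - u(t), the basic relation satisfied by t over S for u in S. *)
Definition diagonal u : P2 := map_poly polyC u - u%:P.

Lemma SX_diagonal u : S u -> SX (diagonal u).
Proof. by move=> Su; apply: SX_D (SX_map u) (SX_N (SX_C Su)). Qed.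

Lemma diagonal_root u : (diagonal u).['X] = 0.
Proof. by rewrite /diagonal hornerD hornerN hornerC evalX_map subrr. Qed.

Lemma size_diagonal u : (1 < size u)%N ->
  size (diagonal u) = size u /\ lead_coef (diagonal u) = (lead_coef u)%:P.
Proof.
move=> su; have smap : size (map_poly polyC u) = size u.
  by rewrite size_map_inj_poly //; apply: polyC_inj.
have ltC : (size (- u%:P : P2) < size (map_poly polyC u))%N.
  by rewrite size_polyN smap (leq_ltn_trans (size_polyC_leq1 _)).
rewrite /diagonal size_polyDl // lead_coefDl // smap; split=> //.
by rewrite lead_coef_map_inj //; apply: polyC_inj.
Qed.

(** A relation Phi of least degree over S divides f(X) - f(t) up to a scalar of
    k[t].  By Gauss its primitive part divides a polynomial with constant leading
    coefficient, so Phi is a monic polynomial times its leading coefficient; the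
    coefficients of the monic one are quotients of elements of S. *)
Lemma minimal_monic_relation : exists Phi : P2,
  [/\ SX Phi, Phi \is monic, Phi.['X] = 0
    & forall E, SX E -> E.['X] = 0 -> exists Q, E = Q * Phi].
Proof.
have [sM lM] := size_diagonal f_nonconst.
have f0 : lead_coef f != 0 by rewrite lead_coef_eq0 -size_poly_gt0 ltnW.
have [|Phi [[Phi0 SPhi rPhi] minPhi]] := @exists_minimal P2 (fun Q => size Q)
    (fun Q => [/\ Q != 0, SX Q & Q.['X] = 0]).
  exists (diagonal f); split; last exact: diagonal_root.
    by rewrite -size_poly_gt0 sM ltnW.
  exact: SX_diagonal.
have divPhi E : SX E -> E.['X] = 0 ->
    exists N Q, (lead_coef Phi ^+ N)%:P * E = Q * Phi.
  move=> SE rE; have [N [Q [R [_ SR eqR sR]]]] := SX_pseudo_division Phi0 SPhi SE.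
  exists N, Q; rewrite eqR; have [->|R0] := eqVneq R 0; first by rewrite addr0.
  have rR : R.['X] = 0.
    have := congr1 (horner^~ 'X) eqR.
    by rewrite /= hornerD !hornerM rE rPhi !mulr0 add0r.
  by have := minPhi R (And3 R0 SR rR); rewrite leqNgt sR.
have [N [Q eqQ]] := divPhi _ (SX_diagonal S_f) (diagonal_root f).
have lN0 : lead_coef Phi ^+ N != 0 by rewrite expf_neq0 ?lead_coef_eq0.
have [r1 [r2 [Q1 [Phi1 [_ def_Phi def_M]]]]] :=
  gauss_split (factorial_poly (@factorial_field k)) lN0 eqQ.
have : lead_coef Q1 * lead_coef Phi1 = (lead_coef f)%:P by rewrite -lead_coefM -def_M.
move=> lQP; have uPhi1 : lead_coef Phi1 \is a GRing.unit.
  have : (lead_coef f)%:P \is a GRing.unit by rewrite rmorph_unit ?unitfE.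
  by rewrite -lQP unitrM => /andP[].
pose Phi2 := (lead_coef Phi1)^-1%:P * Phi1.
have l2 : lead_coef Phi2 = 1 by rewrite lead_coefM lead_coefC mulVr.
have Phi2E : Phi = (lead_coef Phi)%:P * Phi2.
  rewrite {2}def_Phi lead_coefM lead_coefC /Phi2 mulrA -polyCM mulrK //.
have lPhi0 : lead_coef Phi != 0 by rewrite lead_coef_eq0.
have SPhi2 : SX Phi2.
  move=> i; apply: (S_div (SPhi i) (SPhi (size Phi).-1) lPhi0).
  by rewrite {1}Phi2E coefCM.
have mPhi2 : Phi2 \is monic by apply/monicP.
have rPhi2 : Phi2.['X] = 0.
  have := rPhi; rewrite Phi2E hornerCM => /eqP.
  by rewrite mulf_eq0 (negbTE lPhi0) => /eqP.
have sPhi2 : size Phi2 = size Phi by rewrite [in RHS]Phi2E mul_polyC size_scale.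
exists Phi2; split=> // E SE rE.
have [|N' [Q' [R [_ SR eqR sR]]]] := SX_pseudo_division _ SPhi2 SE.
  exact: monic_neq0.
exists Q'; move: eqR; rewrite (monicP mPhi2) expr1n mul1r => eqR.
rewrite eqR; have [->|R0] := eqVneq R 0; first by rewrite addr0.
have rR : R.['X] = 0.
  have := congr1 (horner^~ 'X) eqR.
  by rewrite /= hornerD hornerM rE rPhi2 mulr0 add0r.
by have := minPhi R (And3 R0 SR rR); rewrite leqNgt -sPhi2 sR.
Qed.

(** Expand u in powers of s, with coefficients of degree less than that of s, and
    replace s(X) by s(t). *)
Lemma powers_mod_diagonal s u : (1 < size s)%N -> exists W : P2,
  [/\ (size W < size s)%N, forall i, exists q, W`_i = q \Po s
    & exists Q, map_poly polyC u - W = Q * diagonal s].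
Proof.
move=> s1; have [l] := ubnP (size u); elim: l => // l IH in u * => le_l.
have [ltus|lesu] := ltnP (size u) (size s).
  exists (map_poly polyC u); split; first by rewrite size_map_inj_poly //; apply: polyC_inj.
    by move=> i; exists (u`_i)%:P; rewrite coef_map comp_polyC.
  by exists 0; rewrite subrr mul0r.
have s0 : s != 0 by rewrite -size_poly_gt0 ltnW.
have [|W [sW WP [Q eqQ]]] := IH (u %/ s)%R.
  by rewrite size_divp //; move: lesu le_l s1; move: (size u) (size s) => x y; lia.
exists (s%:P * W + map_poly polyC (u %% s)); split.
- apply: leq_ltn_trans (size_polyD _ _) _; rewrite gtn_max.
  rewrite size_map_inj_poly ?ltn_modp ?s0 ?andbT //; last exact: polyC_inj.
  by rewrite mul_polyC (leq_ltn_trans (size_scale_leq _ _)).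
- move=> i; have [q Wi] := WP i; exists ('X * q + ((u %% s)`_i)%:P).
  by rewrite coefD coefCM Wi coef_map comp_polyD comp_polyM comp_polyX comp_polyC.
exists (map_poly polyC (u %/ s) + s%:P * Q).
rewrite {1}(divp_eq u s) !rmorphD rmorphM /= mulrDl -mulrA -eqQ /diagonal; ring.
Qed.

(** Let s be a coefficient of Phi of maximal degree in t.  Then Phi divides
    s(X) - s(t), and both have the same degree in t, so the quotient lies in
    k[X]; as the coefficient of highest degree in t of s(X) - s(t) is a constant,
    so is the quotient.  For u in S, the polynomial s(X) - s(t) therefore divides
    u(X) - u(t), hence W(X) - u(t) for the polynomial W over k[s] congruent to
    u(X); comparing degrees in X gives u = W. *)
Theorem luroth_subalgebra : exists s, [/\ S s, (1 < size s)%N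
  & forall u, S u -> exists q, u = q \Po s].
Proof.
have [Phi [SPhi mPhi rPhi divPhi]] := minimal_monic_relation.
have Phi0 : Phi != 0 by apply: monic_neq0.
have sY1 : (1 < sizeY Phi)%N.
  rewrite ltnNge; apply/negP => sY; case/negP: Phi0.
  have PhiE : Phi = map_poly polyC (map_poly (fun u : {poly k} => u`_0) Phi).
    apply/polyP => i; rewrite coef_map coef_map_id0 ?coef0 //=.
    by apply: size1_polyC; apply: leq_trans (max_size_coefXY _ _) sY.
  by move: rPhi; rewrite PhiE evalX_map => ->; rewrite rmorph0.
have [i0 sE] : exists i, sizeY Phi = size Phi`_i.
  have := @eq_bigmax_cond 'I_(size Phi) predT (fun i => size Phi`_i).
  by rewrite card_ord size_poly_gt0 => /(_ Phi0)[i _ ?]; exists i.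
set s := Phi`_i0 in sE; have s1 : (1 < size s)%N by rewrite -sE.
have Ss : S s by apply: SPhi.
have [Q eqQ] := divPhi _ (SX_diagonal Ss) (diagonal_root s).
(* exchanging X and t turns degrees in t into sizes *)
have sw : swapXY (diagonal s) = - diagonal s.
  by rewrite [in LHS]/diagonal raddfB /= swapXY_polyC swapXY_map_polyC -opprB.
have [sD lD] := size_diagonal s1.
have ls0 : lead_coef s != 0 by rewrite lead_coef_eq0 -size_poly_gt0 ltnW.
have D0 : diagonal s != 0 by rewrite -size_poly_gt0 sD ltnW.
have Q0 : Q != 0 by apply: contraNneq D0 => Q0; rewrite eqQ Q0 mul0r.
have eqsw : - diagonal s = swapXY Q * swapXY Phi by rewrite -sw eqQ rmorphM.
have swP0 : swapXY Phi != 0 by rewrite swapXY_eq0.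
have swQ0 : swapXY Q != 0 by rewrite swapXY_eq0.
have [q swQ] : exists q, swapXY Q = q%:P.
  exists (swapXY Q)`_0; apply: size1_polyC.
  have := congr1 (fun p : P2 => size p) eqsw; rewrite /= size_polyN sD size_mul //.
  rewrite -(sizeYE Phi) sE; move: s1; move: (size s) (size (swapXY Q)) => x y.
  by lia.
have [c c0 qE] : exists2 c : k, c != 0 & q = c%:P.
  have := congr1 (fun p : P2 => lead_coef p) eqsw.
  rewrite /= lead_coefN lD lead_coefM swQ lead_coefC -polyCN => /esym eqlead.
  have : q \is a GRing.unit.
    suff : q * lead_coef (swapXY Phi) \is a GRing.unit by rewrite unitrM => /andP[].
    by rewrite eqlead rmorph_unit // unitfE oppr_eq0.
  rewrite poly_unitE => /andP[/eqP sq uq]; exists q`_0; first by rewrite -unitfE.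
  by apply: size1_polyC; rewrite sq.
have QE : Q = (c%:P)%:P by rewrite -[Q]swapXYK swQ qE swapXY_polyC map_polyC.
exists s; split=> // u Su.
have [Q' eqQ'] := divPhi _ (SX_diagonal Su) (diagonal_root u).
have [W [sW WP [Q'' eqW]]] := powers_mod_diagonal u s1.
have [q0 W0] := WP 0; exists q0; rewrite -W0.
suff -> : W = u%:P by rewrite coefC.
apply/eqP; rewrite -subr_eq0; apply/negPn/negP => nz.
have eqd : W - u%:P = (Q' * (c^-1%:P)%:P - Q'') * diagonal s.
  rewrite mulrBl -eqW {1}eqQ QE mulrA -[Q' * _ * _]mulrA -!polyCM mulVf // !polyC1 mulr1.
  by rewrite -eqQ' /diagonal; ring.
have Qnz : Q' * (c^-1%:P)%:P - Q'' != 0.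
  by apply: contraNneq nz => Qz; rewrite eqd Qz mul0r.
have : (size (W - u%:P)%R < size s)%N.
  apply: leq_ltn_trans (size_polyD _ _) _; rewrite gtn_max sW size_polyN.
  exact: leq_ltn_trans (size_polyC_leq1 _) s1.
rewrite eqd size_mul // sD; move: Qnz; rewrite -size_poly_gt0.
by clear -s1; move: (size _) (size s) s1 => x y; lia.
Qed.

End SubalgebrasOfUnivariatePolynomials.

(** * Primes and integral closedness in a retract *)

Section RetractPrimes.

Variables (k : fieldType) (n : nat) (h : n.-tuple {mpoly k[n]}).
Local Notation P := {mpoly k[n]}.
Local Notation phi := (comp_mpoly h).
Hypothesis idem : forall p, phi (phi p) = phi p.
Implicit Types (a b p u v w x : P).

Lemma retr_prime_exp p u i : retr_prime h p -> retr h u -> divides p (u ^+ i) ->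
  divides p u.
Proof.
move=> [rp np pp] ru; elim: i => [|i IH].
  case=> z; rewrite expr0 => eq1; case/negP: np; apply: is_const_unit.
  by apply/unitrPr; exists z.
by rewrite exprS => /pp[||//|]; last exact: IH; rewrite // ; apply: retrX.
Qed.

Lemma retr_prime_assoc p x : retr_prime h p -> retr_prime h x -> divides p x ->
  exists2 c : k, c != 0 & p = c *: x.
Proof.
move=> pp px [z def_x]; have x0 := retr_prime_neq0 px; have p0 := retr_prime_neq0 pp.
have [rp np _] := pp; have [rx _ xx] := px.
have rz : retr h z by apply: (retr_quotient p0 rp); rewrite -def_x.
have : divides x (p * z) by rewrite -def_x; apply: divides_refl.
case/(xx _ _ rp rz) => [[w def_p]|[w def_z]].
  have /is_constP[c def_w] : is_const w.
    apply: is_const_unit; apply/unitrPr; exists z; apply: (mulfI x0).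
    by rewrite mulrA -def_p -def_x mulr1.
  exists c; last by rewrite def_p def_w mulrC mul_mpolyC.
  by apply: contraNneq p0 => c0; rewrite def_p def_w c0 mulr0.
case/negP: np; apply: is_const_unit; apply/unitrPr; exists w.
by apply: (mulfI x0); rewrite mulrCA -def_z mulr1.
Qed.

(** The retract is integrally closed, being factorial: if u / v is integral then
    each prime factor of v divides u and can be cancelled. *)
Lemma retr_integral_divides u v N (c : nat -> P) : retr h u -> retr h v -> v != 0 ->
    (forall j, retr h (c j)) ->
    u ^+ N + \sum_(j < N) c j * u ^+ j * v ^+ (N - j) = 0 -> divides v u.
Proof.
move=> ru rv v0 rc; have [a [ps [a0 pps def_v]]] := retr_factorization idem rv v0.
move: def_v v0 rv; elim: ps pps u v ru => [|p ps IH] pps u v ru.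
  rewrite big_nil => -> _ _ _; exists (a^-1 *: u).
  by rewrite -scalerAl mul1r scalerA mulfV // scale1r.
have pp : retr_prime h p by apply/pps/mem_head.
have p0 := retr_prime_neq0 pp; have [rp _ _] := pp.
rewrite big_cons scalerAr; set v1 := _ *: _ => def_v v0 rv rel.
have v10 : v1 != 0 by apply: contraNneq v0 => v10; rewrite def_v v10 mulr0.
have rv1 : retr h v1 by apply: (retr_quotient p0 rp); rewrite -def_v.
have [u1 def_u] : divides p u.
  apply: (@retr_prime_exp p u N pp ru).
  have -> : u ^+ N = - \sum_(j < N) c j * u ^+ j * v ^+ (N - j).
    by apply/eqP; rewrite -addr_eq0 rel.
  rewrite -mulN1r; apply: divides_mull.
  elim/big_rec: _ => [|j x _]; first exact: divides0.
  apply: dividesD; apply: divides_mull; rewrite def_v exprMn.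
  have ltj := ltn_ord j; rewrite -(prednK (_ : 0 < N - j)%N) ?subn_gt0 // exprS.
  by apply/divides_mulr/divides_mulr/divides_refl.
have ru1 : retr h u1 by apply: (retr_quotient p0 rp); rewrite -def_u.
rewrite def_u def_v; suff [z ->] : divides v1 u1 by exists z; rewrite mulrA.
apply: (IH (fun q qs => pps q (mem_behead (s := p :: ps) qs)) u1 v1 ru1 erefl v10 rv1).
apply: (mulfI (expf_neq0 N p0)); rewrite mulr0 -[RHS]rel mulrDr def_u -exprMn.
congr (_ + _); rewrite mulr_sumr; apply: eq_bigr => j _.
rewrite def_v !exprMn -{1}(subnKC (ltnW (ltn_ord j))) exprD; ring.
Qed.

End RetractPrimes.

(** * Nonconstant elements and lines *)

Section Transcendental.

Variables (k : closedFieldType) (n : nat).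
Local Notation P := {mpoly k[n]}.

Lemma nonconst_transcendental (s : P) (q : {poly k}) : ~~ is_const s -> q != 0 ->
  evp (@mpolyC n k) s q != 0.
Proof.
move=> ns q0; have [r ->] := closed_field_poly_normal q.
rewrite -mul_polyC rmorphM /= evpC mulf_neq0 ?mpolyC_eq0 ?lead_coef_eq0 //.
rewrite rmorph_prod /= prodf_seq_neq0; apply/allP => i _ /=.
rewrite rmorphB /= evpX evpC subr_eq0; apply: contraNneq ns => ->.
by apply/is_constP; exists i.
Qed.

Lemma nonconst_two_values (f : P) : ~~ is_const f -> exists x y, f.@[x] != f.@[y].
Proof.
move=> nf; apply: NNPP => none; case/negP: nf; apply/is_constP.
exists f.@[fun _ => 0]; apply/eqP; rewrite -subr_eq0; apply/eqP/vanishing_mpoly => v.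
rewrite mevalB mevalC; apply/eqP; rewrite subr_eq0; apply/negPn/negP => ne.
by apply: none; exists v, (fun _ => 0).
Qed.

Lemma line_eval c (v : 'rV[k]_n) (f : P) t :
  (line c v f).[t] = f.@[fun i => c i + v 0 i * t].
Proof.
rewrite -[LHS]/(horner_eval t (line c v f)) /line rmorph_mmap.
apply: eq_mmap => [a|i] /=; first by rewrite /horner_eval hornerC.
by rewrite /horner_eval !hornerE.
Qed.

Lemma nonconst_line (f : P) : ~~ is_const f ->
  exists c (v : 'rV[k]_n), (1 < size (line c v f))%N.
Proof.
move=> /nonconst_two_values[x [y ne]]; exists x, (\row_i (y i - x i)).
rewrite ltnNge; apply/negP => /size1_polyC eqC; case/eqP: ne.
set g : {poly k} := line _ _ _ in eqC.
have g0 : g.[0] = f.@[x].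
  by rewrite line_eval; apply: meval_eq => i; rewrite mxE mulr0 addr0.
have g1 : g.[1] = f.@[y].
  by rewrite line_eval; apply: meval_eq => i; rewrite mxE mulr1 addrC subrK.
by rewrite -g0 -g1 eqC !hornerC.
Qed.

End Transcendental.

(** * The part of degree zero *)

Section DegreeZeroPart.

Variables (k : closedFieldType) (n : nat) (h : n.-tuple {mpoly k[n]}).
Local Notation P := {mpoly k[n]}.
Local Notation phi := (comp_mpoly h).
Hypothesis idem : forall p, phi (phi p) = phi p.
Variables (A : {pred P}) (G : int -> P -> Prop).
Hypothesis AE : forall a, a \in A <-> retr h a.
Hypothesis grA : Zgrading A G.
Implicit Types (a b p u v w x s : P) (d e l : int).

Definition uni s : {rmorphism {poly k} -> P} := evp (@mpolyC n k) s.
Definition bi s x : {rmorphism {poly {poly k}} -> P} := evp (uni s) x.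
Definition tri s x w : {rmorphism {poly {poly {poly k}}} -> P} := evp (bi s x) w.

Hypothesis dependent3 : forall u v w, retr h u -> retr h v -> retr h w ->
  exists2 Q, Q != 0 & tri u v w Q = 0.

Lemma G0_uni s q : G 0 s -> G 0 (uni s q).
Proof.
move=> Gs; rewrite /uni /= evp_sum; apply: (G_sum grA) => i _.
rewrite mul_mpolyC; apply: (G_Z grA).
by have := G_X AE grA i Gs; rewrite mul0r.
Qed.

Lemma evp_hom (R : nzRingType) (f : {rmorphism R -> P}) x e (Q : {poly R}) :
    (forall r, G 0 (f r)) -> G e x ->
  forall i, G (e * i%:Z) (f Q`_i * x ^+ i).
Proof.
by move=> Gf Gx i; rewrite -[e * _]add0r; apply: (G_M grA) (Gf _) _; apply: (G_X AE grA).
Qed.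

Lemma homogeneous_relation (R : nzRingType) (f : {rmorphism R -> P}) x e (Q : {poly R}) :
    (forall r, G 0 (f r)) -> e != 0 -> x != 0 -> G e x -> evp f x Q = 0 ->
  forall i, f Q`_i = 0.
Proof.
move=> Gf e0 x0 Gx; rewrite evp_sum => rel i.
have [lti|lei] := ltnP i (size Q); last by rewrite nth_default ?rmorph0.
have H := homog_sum0 grA (e := fun j : 'I_(size Q) => e * j%:Z) _ _ rel (Ordinal lti).
have /eqP : f Q`_i * x ^+ i = 0.
  apply: H => [j j'|j]; last exact: (evp_hom _ Gf Gx).
  by move/(mulfI e0) => [] /val_inj.
by rewrite mulf_eq0 expf_eq0 (negbTE x0) andbF orbF => /eqP.
Qed.

(** In a relation between u, v of degree zero and w of nonzero degree, the
    coefficients of the powers of w vanish separately. *)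
Lemma G0_dependent2 u v w e : e != 0 -> w != 0 -> G e w -> G 0 u -> G 0 v ->
  exists2 Q, Q != 0 & bi u v Q = 0.
Proof.
move=> e0 w0 Gw Gu Gv.
have [Q Q0 rel] := dependent3 (G_retr AE grA Gu) (G_retr AE grA Gv) (G_retr AE grA Gw).
exists (lead_coef Q); first by rewrite lead_coef_eq0.
apply: (homogeneous_relation _ e0 w0 Gw rel) => r; rewrite /bi /= evp_sum.
apply: (G_sum grA) => i _; have := evp_hom r (fun q => G0_uni q Gu) Gv i.
by rewrite mul0r.
Qed.

(** The variable is a root of F(X) - F, which is monic up to a scalar. *)
Lemma integral_over_nonconst (F w : {poly k}) : (1 < size F)%N ->
  integralOver (comp_poly F) w.
Proof.
move=> F1; have lF : lead_coef F != 0 by rewrite lead_coef_eq0 -size_poly_gt0 ltnW.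
have intX : integralOver (comp_poly F) ('X : {poly k}).
  exists ((lead_coef F)^-1%:P%:P * (map_poly polyC F - 'X%:P)).
    have sm : size (map_poly polyC F : {poly {poly k}}) = size F.
      by rewrite size_map_inj_poly //; apply: polyC_inj.
    apply/monicP; rewrite lead_coefM lead_coefC lead_coefDl; last first.
      by rewrite size_polyN sm (leq_ltn_trans (size_polyC_leq1 _)).
    by rewrite lead_coef_map_inj //; [rewrite -polyCM mulVf|apply: polyC_inj].
  rewrite /root rmorphM rmorphB /= !map_polyC /= comp_polyX hornerM hornerD hornerN.
  rewrite hornerC -map_poly_comp (eq_map_poly (g := polyC)) => [|a]; last exact: comp_polyC.
  by rewrite -/(comp_poly _ _) comp_polyXr hornerC subrr mulr0.
have -> : w = (map_poly polyC w).['X] by rewrite evalX_map.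
apply: integral_horner intX => c /(nthP 0)[i _ <-]; rewrite coef_map /=.
by rewrite -(comp_polyC (w`_i) F); apply: integral_id.
Qed.

(** Restriction rho to a line on which f is not constant is injective in degree
    zero, because every u of degree zero is algebraic over k(f).  The image of
    the degree zero part contains its quotients y = rho u / rho u' that are
    polynomials: these are integral over k[rho f], and the equation lifts to an
    integral equation for u / u'. *)
Theorem degree_zero_part f w e : e != 0 -> w != 0 -> G e w -> G 0 f -> ~~ is_const f ->
  exists s, [/\ G 0 s, ~~ is_const s & forall a, G 0 a -> exists q, a = uni s q].
Proof.
move=> e0 w0 Gw Gf nf; have [c [v F1]] := nonconst_line nf.
set rho := line c v in F1; pose F := rho f.
have rho_uni u q : rho (uni u q) = q \Po rho u.
  rewrite /uni /= rmorph_evp /evp; congr (_.[_]); apply: eq_map_poly => a.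
  exact: lineC.
have rho_inj u : G 0 u -> rho u = 0 -> u = 0.
  move=> Gu ru0; apply/eqP/negPn/negP => u0.
  have [Q Q0 rel] := G0_dependent2 e0 w0 Gw Gf Gu.
  have [p p0] := evp_restrict0 u0 ru0 Q0 rel.
  rewrite rho_uni => /eqP; rewrite comp_poly_eq0 // => /eqP p0'.
  by rewrite p0' eqxx in p0.
pose S (y : {poly k}) := exists2 u, G 0 u & y = rho u.
have [||||||s [[s0 Gs0 def_s] s1 genS]] := @luroth_subalgebra k S F.
- by move=> a; exists a%:MP; [apply: (G_C AE grA)|rewrite lineC].
- by move=> _ _ [u Gu ->] [u' Gu' ->]; exists (u + u'); [apply: (G_D grA)|rewrite rmorphD].
- move=> _ _ [u Gu ->] [u' Gu' ->]; exists (u * u'); last by rewrite rmorphM.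
  by rewrite -[0](addr0 0); apply: (G_M grA).
- move=> _ _ y [u Gu ->] [u' Gu' ->] ru'0 eq_uy.
  have u'0 : u' != 0 by apply: contraNneq ru'0 => ->; rewrite rmorph0.
  have [D mD rootD] := integral_over_nonconst y F1.
  have sD : size D = (size D).-1.+1 by rewrite prednK // size_poly_gt0 monic_neq0.
  set N := (size D).-1 in sD.
  have [z def_u] : divides u' u.
    apply: (@retr_integral_divides k n h idem u u' N (fun j => uni f D`_j)) => //.
    + exact: (G_retr AE grA Gu).
    + exact: (G_retr AE grA Gu').
    + by move=> j; apply: (G_retr AE grA (G0_uni _ Gf)).
    apply: rho_inj.
      have GX' a i : G 0 a -> G 0 (a ^+ i).
        by move=> Ga; have := G_X AE grA i Ga; rewrite mul0r.
      have GM' a b : G 0 a -> G 0 b -> G 0 (a * b).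
        by move=> Ga Gb; have := G_M grA Ga Gb; rewrite addr0.
      apply: (G_D grA); first exact: GX'.
      by apply: (G_sum grA) => j _; apply: (GM'); [apply: (GM'); [apply: G0_uni|apply: GX']|apply: GX'].
    rewrite rmorphD rmorph_sum rmorphXn /= eq_uy.
    move/rootP: rootD; rewrite (@horner_coef_wide _ N.+1); last first.
      by rewrite -sD size_poly.
    rewrite big_ord_recr /= !coef_map /= -/N -lead_coefE (monicP mD) rmorph1 mul1r => rel.
    transitivity (rho u' ^+ N * 0); last by rewrite mulr0.
    rewrite -[in RHS]rel mulrDr addrC exprMn; congr (_ + _); rewrite mulr_sumr.
    apply: eq_bigr => j _; rewrite !rmorphM !rmorphXn /= rho_uni coef_map /= eq_uy exprMn.
    have eN : rho u' ^+ N = rho u' ^+ j * rho u' ^+ (N - j).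
      by rewrite -exprD subnKC // ltnW.
    by move: eN; rewrite /rho /line /= => ->; ring.
  exists z.
    have [u0|u0] := eqVneq u 0.
      move/esym/eqP: def_u; rewrite u0 mulf_eq0 (negbTE u'0) => /eqP ->.
      exact: (G_0 grA).
    have rz : retr h z.
      by apply: (retr_quotient u'0 (G_retr AE grA Gu')); rewrite -def_u; apply: (G_retr AE grA Gu).
    have [e' [Ge' Gz]] := hom_factor AE grA u0 Gu (G_retr AE grA Gu') rz def_u.
    by move: Gz; rewrite -(deg_unique grA u'0 Gu' Ge') subr0.
  apply: (mulfI ru'0); by rewrite -eq_uy def_u rmorphM.
- by exists f.
- exact: F1.
exists s0; split=> // [|a Ga].
  apply: contraTN s1 => /is_constP[a s0a].
  by rewrite -leqNgt def_s s0a lineC size_polyC_leq1.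
have [|q eqa] := genS (rho a); first by exists a.
exists q; apply/eqP; rewrite -subr_eq0; apply/eqP/rho_inj.
  by apply: (G_B grA) => //; apply: G0_uni.
by rewrite rmorphB /= rho_uni eqa def_s subrr.
Qed.

End DegreeZeroPart.

(** * Homogeneous primes of nonzero degree *)

Section Generators.

Variables (k : closedFieldType) (n : nat) (h : n.-tuple {mpoly k[n]}).
Local Notation P := {mpoly k[n]}.
Local Notation phi := (comp_mpoly h).
Hypothesis idem : forall p, phi (phi p) = phi p.
Variables (A : {pred P}) (G : int -> P -> Prop).
Hypothesis AE : forall a, a \in A <-> retr h a.
Hypothesis grA : Zgrading A G.
Implicit Types (a b p g u v w x y : P) (d e l : int).
Local Notation hom_prime := (hom_prime h G).

Lemma positive_prime d a : a != 0 -> G d a -> 0 < d ->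
  exists e x, 0 < e /\ hom_prime e x.
Proof.
move=> a0 Ga d0; have [c [ps [c0 pps def_a]]] := hom_factorization idem AE grA a0 Ga.
apply: NNPP => none.
have [d' d'0 Gd'] : exists2 d', d' <= 0 & G d' (\prod_(p <- ps) p).
  rewrite big_seq; elim/big_rec: _ => [|p x /pps[e ep] [d' d'0 Gx]].
    by exists 0 => //; apply: (G_1 AE grA).
  exists (e + d'); last by apply: (G_M grA) => //; case: ep.
  have : e <= 0 by rewrite leNgt; apply/negP => e0; apply: none; exists e, p.
  lia.
have : d = d' by apply: (deg_unique grA a0 Ga); rewrite def_a; apply: (G_Z grA).
lia.
Qed.

Lemma hom_prime_neq0 d p : hom_prime d p -> p != 0.
Proof. by case=> /retr_prime_neq0. Qed.

Lemma hom_quotient d e u v : v != 0 -> G e u -> G d (u * v) -> retr h v -> u != 0 ->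
  G (d - e) v.
Proof.
move=> v0 Gu Guv rv u0; have uv0 : u * v != 0 by rewrite mulf_neq0.
have [e' [Ge' Gv]] := hom_factor AE grA uv0 Guv (G_retr AE grA Gu) rv erefl.
by rewrite (deg_unique grA u0 Gu Ge').
Qed.

Lemma retr_evp (R : nzRingType) (f : {rmorphism R -> P}) x (Q : {poly R}) :
  (forall r, retr h (f r)) -> retr h x -> retr h (evp f x Q).
Proof.
move=> rf rx; rewrite evp_sum; elim/big_rec: _ => [|i y _ ry]; first exact: retr0.
by apply: retrD => //; apply: retrM => //; apply: retrX.
Qed.

Hypothesis dependent3 : forall u v w, retr h u -> retr h v -> retr h w ->
  exists2 Q, Q != 0 & tri u v w Q = 0.
Variable s : P.
Hypotheses (Gs : G 0 s) (ns : ~~ is_const s).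
Hypothesis genG0 : forall a, G 0 a -> exists q, a = uni s q.

Lemma retr_uni q : retr h (uni s q).
Proof. exact: (G_retr AE grA (G0_uni AE grA q Gs)). Qed.

(** Take a relation between s, g and x not divisible by x.  Modulo x it becomes a
    nonzero relation between s and g, whose components uni s q * g^i are all
    divisible by the prime x.  Now x does not divide uni s q for q <> 0, since the
    quotient would have negative degree; so x divides g. *)
Lemma parabolic_divides d x e g : (forall d a, a != 0 -> G d a -> 0 <= d) ->
  hom_prime d x -> 0 < d -> G e g -> 0 < e -> divides x g.
Proof.
move=> G_ge0 [px Gx] d0 Gg e0; have x0 := retr_prime_neq0 px.
have [rx nx xx] := px; have rg := G_retr AE grA Gg.
have [Q Q0 rel] := dependent3 (G_retr AE grA Gs) rg rx.
have [p p0 [Q' eqp]] := evp_divides x0 Q0 rel.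
have rQ' : retr h (evp (bi s g) x Q').
  by apply: retr_evp => // r; apply: retr_evp => // q; apply: retr_uni.
have lp0 : lead_coef p != 0 by rewrite lead_coef_eq0.
have G0 (q : {poly k}) : G 0 (uni s q) := G0_uni AE grA q Gs.
have sp : (0 < size p)%N by rewrite size_poly_gt0.
have ltp : ((size p).-1 < size p)%N by rewrite prednK.
have dvd := homog_sum_divides AE grA (e := fun i : 'I_(size p) => e * i%:Z)
  (x := fun i : 'I_(size p) => uni s p`_i * g ^+ i) _ _ Gx rQ' _ (Ordinal ltp).
have : divides x (uni s (lead_coef p) * g ^+ (size p).-1).
  apply: dvd => [j j'|j|].
  - by move/(mulfI (lt0r_neq0 e0)) => [] /val_inj.
  - exact: (evp_hom AE grA _ G0 Gg).
  by rewrite -eqp /bi /= evp_sum.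
case/(xx _ _ (retr_uni _) (retrX _ rg)) => [[z def_z]|]; last first.
  exact: (retr_prime_exp px rg).
have u0 := nonconst_transcendental ns lp0.
have z0 : z != 0 by apply: contraNneq u0 => z0; rewrite -[evp _ _ _]/(uni s _) def_z z0 mulr0.
have Gz : G (0 - d) z.
  apply: (hom_quotient z0 Gx) => //; first by rewrite -def_z.
  by apply: (retr_quotient x0 rx); rewrite -def_z; apply: retr_uni.
by have := G_ge0 _ _ z0 Gz; clear -d0; lia.
Qed.

(** Generation is expressed by an arbitrary predicate T closed under the algebra
    operations, so that one statement serves any choice of generators. *)
Section Closed.

Variable T : P -> Prop.
Hypothesis TC : forall c, T c%:MP.
Hypothesis TD : forall a b, T a -> T b -> T (a + b).
Hypothesis TM : forall a b, T a -> T b -> T (a * b).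

Lemma closed_uni a q : T a -> T (uni a q).
Proof.
move=> Ta; rewrite /uni /= evp_sum; elim/big_rec: _ => [|i x _ Tx].
  by rewrite -mpolyC0; apply: TC.
apply: TD => //; apply: TM; first exact: TC.
elim: (i : nat) => [|j IH].
  by rewrite expr0 -mpolyC1; apply: TC.
by rewrite exprS; apply: TM.
Qed.

Lemma closed_G0 a : T s -> G 0 a -> T a.
Proof. by move=> Ts /genG0[q ->]; apply: closed_uni. Qed.

Lemma parabolic_generators d x : (forall d a, a != 0 -> G d a -> 0 <= d) ->
  hom_prime d x -> 0 < d -> T s -> T x -> forall a, retr h a -> T a.
Proof.
move=> G_ge0 px d0 Ts Tx.
apply: (homogeneous_generate AE grA) => //; first by rewrite -mpolyC0; apply: TC.
move=> e g g0 Gg; have [N] := ubnP (absz e).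
elim: N => // N IH in e g g0 Gg *; rewrite ltnS => leN.
have e_ge0 := G_ge0 _ _ g0 Gg.
have [e0|e0] := eqVneq e 0; first by apply: closed_G0; rewrite -?e0.
have [z def_g] : divides x g by apply: (parabolic_divides G_ge0 px d0 Gg); lia.
have z0 : z != 0 by apply: contraNneq g0 => z0; rewrite def_g z0 mulr0.
have [[rx _ _] Gx] := px; have x0 := hom_prime_neq0 px.
have Gz : G (e - d) z.
  apply: (hom_quotient z0 Gx) => //; first by rewrite -def_g.
  by apply: (retr_quotient x0 rx); rewrite -def_g; apply: (G_retr AE grA Gg).
rewrite def_g; apply: TM => //; apply: (IH _ _ z0 Gz).
by have := G_ge0 _ _ z0 Gz; clear -d0 e_ge0 leN e0; lia.
Qed.

End Closed.

(** Some product of powers of x and y has degree zero, so it is a nonconstant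
    polynomial in s and is divisible by some s - lam.  The only prime factors of
    s - lam are then x and y, and both occur since its degree is zero. *)
Lemma opposite_primes d x e y : hom_prime d x -> 0 < d -> hom_prime e y -> e < 0 ->
  exists lam c i j, [/\ c != 0, (0 < i)%N, (0 < j)%N &
                       s - lam%:MP = c *: (x ^+ i * y ^+ j)].
Proof.
move=> hx d0 hy e0; have [px Gx] := hx; have [py Gy] := hy.
have [rx nx xx] := px; have [ry ny yy] := py.
pose z := x ^+ (absz e) * y ^+ (absz d).
have Gz : G 0 z.
  have := G_M grA (G_X AE grA (absz e) Gx) (G_X AE grA (absz d) Gy).
  by congr G; nia.
have z0 : z != 0 by rewrite mulf_neq0 // expf_neq0 // ?(hom_prime_neq0 hx) ?(hom_prime_neq0 hy).
have nz : ~~ is_const z.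
  apply: contra nx => cz; apply: (@is_const_factor _ _ x (x ^+ (absz e).-1 * y ^+ (absz d))).
    by rewrite mulrA -exprS prednK //; lia.
  by rewrite mulrA -exprS prednK //; lia.
have [q def_z] := genG0 Gz.
have [lam /factor_theorem[q1 def_q]] : exists lam, root q lam.
  apply/closed_rootP; apply: contra nz => /eqP sq.
  rewrite def_z (size1_polyC (_ : (size q <= 1)%N)) ?sq //.
  by rewrite /uni /= evpC; apply/is_constP; eexists.
pose s1 := s - lam%:MP.
have s1E : uni s ('X - lam%:P) = s1 by rewrite /uni /= rmorphB /= evpX evpC.
have Gs1 : G 0 s1 by rewrite -s1E; apply: (G0_uni AE grA).
have ns1 : ~~ is_const s1.
  apply: contra ns => /is_constP[c sc]; apply/is_constP; exists (c + lam).
  by rewrite mpolyCD -sc subrK.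
have s10 : s1 != 0 by apply: contraNneq ns1 => ->; rewrite /is_const msize0.
have s1z : divides s1 z.
  by exists (uni s q1); rewrite def_z def_q rmorphM s1E mulrC.
have [c [ps [c0 pps def_s1]]] := hom_factorization idem AE grA s10 Gs1.
have [c' [i [j [c'0 def_ps]]]] : exists c' i j, c' != 0 /\
    \prod_(p <- ps) p = c' *: (x ^+ i * y ^+ j).
  have {}pps p : p \in ps -> (exists2 c : k, c != 0 & p = c *: x) \/
      (exists2 c : k, c != 0 & p = c *: y).
    move=> psp; have [e' [pp Gp]] := pps p psp; have [rp np ppr] := pp.
    have : divides p z.
      apply: divides_trans s1z; rewrite def_s1 (big_rem _ psp) /= scalerAr.
      by eexists.
    case/ppr => [||pX|pY]; try exact: retrX.
      by left; exact: (retr_prime_assoc pp px (retr_prime_exp pp rx pX)).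
    by right; exact: (retr_prime_assoc pp py (retr_prime_exp pp ry pY)).
  rewrite big_seq; elim/big_rec: _ => [|p w /pps pw [c' [i [j [c'0 ->]]]]].
    by exists 1, 0, 0; rewrite oner_eq0 !expr0 mulr1 scale1r.
  case: pw => [[c1 c10 ->]|[c1 c10 ->]].
    exists (c1 * c'), i.+1, j; rewrite mulf_neq0 //; split=> //.
    by rewrite -scalerAl -scalerAr scalerA exprS mulrA.
  exists (c1 * c'), i, j.+1; rewrite mulf_neq0 //; split=> //.
  by rewrite -scalerAl -scalerAr scalerA exprS mulrCA.
exists lam, (c * c'), i, j; rewrite mulf_neq0 //.
have s1E' : s1 = (c * c') *: (x ^+ i * y ^+ j) by rewrite def_s1 def_ps scalerA.
have degs : d * i%:Z + e * j%:Z = 0.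
  apply: (deg_unique grA s10 _ Gs1); rewrite s1E'; apply: (G_Z grA).
  exact: (G_M grA (G_X AE grA i Gx) (G_X AE grA j Gy)).
have ij0 : (i != 0) || (j != 0).
  apply: contraR ns1; rewrite negb_or !negbK => /andP[/eqP i0 /eqP j0].
  by rewrite s1E' i0 j0 !expr0 mulr1; apply/is_constP; eexists; rewrite -mul_mpolyC mulr1.
by split=> //; clear -d0 e0 degs ij0; nia.
Qed.

Lemma opposite_primes_not_divides d x e y : hom_prime d x -> 0 < d ->
  hom_prime e y -> e < 0 -> ~ divides x y.
Proof.
move=> hx d0 hy e0 xy; have [c c0 def_x] := retr_prime_assoc hx.1 hy.1 xy.
have x0 := hom_prime_neq0 hx.
have : d = e.
  by apply: (deg_unique grA x0 hx.2); rewrite def_x; apply: (G_Z grA); case: hy.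
lia.
Qed.

(** The constants lam attached by [opposite_primes] to (x, y) and to (x', y) agree,
    for otherwise y would divide their difference.  Thus x and x' divide the same
    s - lam, which has a single prime factor of positive degree. *)
Lemma positive_prime_unique d x d' x' e y : hom_prime d x -> 0 < d ->
    hom_prime d' x' -> 0 < d' -> hom_prime e y -> e < 0 ->
  exists2 c : k, c != 0 & x' = c *: x.
Proof.
move=> hx d0 hx' d'0 hy e0; have [px Gx] := hx; have [px' Gx'] := hx'.
have [py Gy] := hy; have [rx' _ x'x'] := px'; have [rx _ _] := px; have [ry ny _] := py.
have [lam [c [i [j [c0 i0 j0 eq_s]]]]] := opposite_primes hx d0 hy e0.
have [lam' [c' [i' [j' [c'0 i'0 j'0 eq_s']]]]] := opposite_primes hx' d'0 hy e0.
have lamE : lam = lam'.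
  apply/eqP/negPn/negP => ne; case/negP: ny.
  have : divides y ((lam' - lam)%:MP).
    have -> : (lam' - lam)%:MP = (s - lam%:MP) - (s - lam'%:MP) :> P.
      by rewrite mpolyCB; ring.
    rewrite eq_s eq_s' -(prednK j0) -(prednK j'0) !exprS.
    by apply: dividesB; rewrite scalerAl mulrCA; eexists.
  case=> z eqz; apply: (@is_const_factor _ _ y z); rewrite -eqz.
    by rewrite mpolyC_eq0 subr_eq0 eq_sym.
  by apply/is_constP; eexists.
apply: (retr_prime_assoc px' px).
have : divides x' (x ^+ i * y ^+ j).
  have -> : x ^+ i * y ^+ j = c^-1 *: (c' *: (x' ^+ i' * y ^+ j')).
    by rewrite -eq_s' -lamE eq_s scalerA mulVf // scale1r.
  by rewrite -(prednK i'0) exprS -mulrA scalerA scalerAr; eexists.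
case/x'x' => [||xx|xy]; try exact: retrX.
  exact: (retr_prime_exp px' rx xx).
case: (opposite_primes_not_divides hx' d'0 hy e0).
exact: (retr_prime_exp px' ry xy).
Qed.

End Generators.

(** * Generators of a graded retract *)

Section Core.

Variables (k : closedFieldType) (n : nat) (h : n.-tuple {mpoly k[n]}).
Local Notation P := {mpoly k[n]}.
Local Notation phi := (comp_mpoly h).
Hypothesis idem : forall p, phi (phi p) = phi p.
Variable A : {pred P}.
Hypothesis AE : forall a, a \in A <-> retr h a.
Implicit Types (a b g u v w x y s : P) (d e l : int) (G : int -> P -> Prop).
Hypothesis dependent3 : forall u v w, retr h u -> retr h v -> retr h w ->
  exists2 Q, Q != 0 & tri u v w Q = 0.

Lemma hyperbolic_generators G s d x e y (T : P -> Prop) :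
    Zgrading A G -> G 0 s -> ~~ is_const s ->
    (forall a, G 0 a -> exists q, a = uni s q) ->
    hom_prime h G d x -> 0 < d -> hom_prime h G e y -> e < 0 ->
    (forall c : k, T c%:MP) -> (forall a b, T a -> T b -> T (a + b)) ->
    (forall a b, T a -> T b -> T (a * b)) -> T x -> T y ->
  forall a, retr h a -> T a.
Proof.
move=> grA Gs ns genG0 hx d0 hy e0 TC TD TM Tx Ty.
have TZ (c : k) a : T a -> T (c *: a) by move=> Ta; rewrite -mul_mpolyC; apply: (TM).
have TX a i : T a -> T (a ^+ i).
  move=> Ta; elim: i => [|i IH]; first by rewrite expr0 -mpolyC1.
  by rewrite exprS; apply: (TM).
have Ts : T s.
  have [lam [c [i [j [_ _ _ eq_s]]]]] := opposite_primes idem AE grA Gs ns genG0 hx d0 hy e0.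
  rewrite -[s](subrK lam%:MP) eq_s; apply: (TD) => //.
  by apply: (TZ); apply: (TM); apply: (TX).
apply: (homogeneous_generate AE grA) => //; first by rewrite -mpolyC0.
move=> l g g0 Gg; have [c [ps [c0 pps ->]]] := hom_factorization idem AE grA g0 Gg.
apply: (TZ); rewrite big_seq; elim/big_rec: _ => [|p w /pps[e' hp] Tw]; first by rewrite -mpolyC1.
apply: (TM) => //; have [pp Gp] := hp.
have [e'0|e'0|e'0] := ltrgtP e' 0.
- have grN := Zgrading_opp grA.
  have toN d' p' : hom_prime h G d' p' -> hom_prime h (fun d => G (- d)) (- d') p'.
    by rewrite /hom_prime opprK.
  have GN0 : G (- 0) s by rewrite oppr0.
  have genN a : G (- 0) a -> exists q, a = uni s q by rewrite oppr0; apply: genG0.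
  have [e_gt0 e'_gt0 d_lt0] : [/\ 0 < - e, 0 < - e' & - d < 0] by split; lia.
  have [c1 _ ->] := positive_prime_unique idem AE grN GN0 ns genN
    (toN _ _ hy) e_gt0 (toN _ _ hp) e'_gt0 (toN _ _ hx) d_lt0.
  exact: TZ.
- have [c1 _ ->] := positive_prime_unique idem AE grA Gs ns genG0 hx d0 hp e'0 hy e0.
  exact: TZ.
by apply: (closed_G0 genG0 TC TD TM Ts); rewrite -e'0.
Qed.

Definition polynomial_generators r (Y : 'I_r -> P) :=
  [/\ forall i, retr h (Y i),
      forall a, retr h a -> exists p, a = mmap (@mpolyC n k) Y p
    & forall Q, mmap (@mpolyC n k) Y Q = 0 -> Q = 0].

(** Two generators suffice for independence, because s of degree zero and x of
    nonzero degree are algebraically independent. *)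
Lemma two_generators G s e x g1 g2 : Zgrading A G -> G 0 s -> ~~ is_const s ->
    e != 0 -> x != 0 -> G e x -> retr h g1 -> retr h g2 ->
    (forall T : P -> Prop, (forall c : k, T c%:MP) ->
      (forall a b, T a -> T b -> T (a + b)) -> (forall a b, T a -> T b -> T (a * b)) ->
      T g1 -> T g2 -> forall a, retr h a -> T a) ->
  polynomial_generators (fun i : 'I_2 => [:: g1; g2]`_i).
Proof.
move=> grA Gs ns e0 x0 Gx r1 r2 gen; pose Y (i : 'I_2) := [:: g1; g2]`_i.
have genY a : retr h a -> exists p, a = mmap (@mpolyC n k) Y p.
  apply: (gen (fun a => exists p, a = mmap (@mpolyC n k) Y p)).
  - by move=> c; exists c%:MP; rewrite mmapC.
  - by move=> _ _ [p ->] [q ->]; exists (p + q); rewrite rmorphD.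
  - by move=> _ _ [p ->] [q ->]; exists (p * q); rewrite rmorphM.
  - by exists 'X_0; rewrite mmapX mmap1U.
  by exists 'X_1; rewrite mmapX mmap1U.
split=> //; first by case=> [[|[|i]]].
move=> Q QY0; apply/eqP/negPn/negP => Q0.
have [p1 def_s] := genY s (G_retr AE grA Gs).
have [p2 def_x] := genY x (G_retr AE grA Gx).
have [q q0] := kernel_dependent (f := mmap (@mpolyC n k) Y) (fun i : 'I_2 => [:: p1; p2]`_i) Q0 QY0.
rewrite (@eq_mmap _ _ _ _ (@mpolyC n k) _ (fun i : 'I_2 => [:: s; x]`_i)); first last.
- by case=> [[|[|i]]].
- by move=> c /=; rewrite mmapC.
rewrite mmap_nest2 => rel.
have rel0 := homogeneous_relation AE grA (f := uni s) (fun q => G0_uni AE grA q Gs) e0 x0 Gx rel.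
case/negP: q0; rewrite -(inj_eq (@nest2_inj k)) rmorph0; apply/eqP/polyP => i.
rewrite coef0; apply/eqP/negPn/negP => qi0.
by have := nonconst_transcendental ns qi0; rewrite -[evp _ _ _]/(uni s _) rel0 eqxx.
Qed.

Lemma positive_degree_generators G w e : Zgrading A G -> w != 0 -> G e w -> 0 < e ->
  exists r (Y : 'I_r -> P), polynomial_generators Y.
Proof.
move=> grA w0 Gw e0; have grN := Zgrading_opp grA.
have [[f [Gf nf]]|constG0] := classic (exists f, G 0 f /\ ~~ is_const f).
  have [s [Gs ns genG0]] :=
    degree_zero_part idem AE grA dependent3 (lt0r_neq0 e0) w0 Gw Gf nf.
  have [d [x [d0 hx]]] := positive_prime idem AE grA w0 Gw e0.
  have x0 := hom_prime_neq0 hx; have [[rx _ _] Gx] := hx.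
  have [[u [e' [u0 Gu e'0]]]|G_ge0] := classic (exists u e', [/\ u != 0, G e' u & e' < 0]).
    have GNu : G (- - e') u by rewrite opprK.
    have e'1 : 0 < - e' by lia.
    have [e1 [y [e10 hy]]] := positive_prime idem AE grN u0 GNu e'1.
    have hy' : hom_prime h G (- e1) y by [].
    have [[ry _ _] _] := hy'.
    exists 2, (fun i : 'I_2 => [:: x; y]`_i).
    apply: (two_generators grA Gs ns (lt0r_neq0 d0) x0 Gx rx ry).
    move=> T TC TD TM Tx Ty; apply: (hyperbolic_generators grA Gs ns genG0 hx d0 hy') => //.
    by lia.
  have {}G_ge0 d' a : a != 0 -> G d' a -> 0 <= d'.
    by move=> a0 Ga; rewrite leNgt; apply/negP => d'0; apply: G_ge0; exists a, d'.
  exists 2, (fun i : 'I_2 => [:: s; x]`_i).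
  apply: (two_generators grA Gs ns (lt0r_neq0 d0) x0 Gx (G_retr AE grA Gs) rx).
  move=> T TC TD TM Ts Tx.
  exact: (parabolic_generators AE grA dependent3 Gs ns genG0 TC TD TM G_ge0 hx d0 Ts Tx).
have {}constG0 a : G 0 a -> is_const a.
  by move=> Ga; apply: NNPP => /negP na; apply: constG0; exists a.
apply: (positive_grading_polynomial idem AE grA _ constG0) => d u u0 Gu.
rewrite leNgt; apply/negP => d0.
have Gz : G 0 (w ^+ absz d * u ^+ absz e).
  have := G_M grA (G_X AE grA (absz d) Gw) (G_X AE grA (absz e) Gu).
  by congr G; nia.
have := constG0 _ Gz; rewrite -(prednK (_ : 0 < absz d)%N); last by lia.
rewrite exprS -mulrA => /is_const_factor; rewrite mulrA -exprS prednK; last by lia.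
rewrite mulf_neq0 ?expf_neq0 // => /(_ isT) /is_constP[c def_w].
have : e = 0 by apply: (deg_unique grA w0 Gw); rewrite def_w; apply: (G_C AE grA).
lia.
Qed.

Theorem graded_retract_generators G : Zgrading A G ->
  ~ (forall a, G 0 a <-> a \in A) -> exists r (Y : 'I_r -> P), polynomial_generators Y.
Proof.
move=> grA /(nontrivial_degree AE grA)[d [a [d0 a0 Ga]]].
have [d_gt0|d_le0] := ltrP 0 d; first exact: (positive_degree_generators grA a0 Ga).
have GNa : G (- - d) a by rewrite opprK.
by apply: (positive_degree_generators (Zgrading_opp grA) a0 GNa); lia.
Qed.

End Core.

(** * Retracts of an algebra isomorphic to a polynomial ring *)

Section Transfer.

Variables (k : closedFieldType) (n : nat) (B : comAlgType k).
Variables (F : {lrmorphism {mpoly k[n]} -> B}) (F' : B -> {mpoly k[n]}).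
Hypotheses (FK : cancel F F') (F'K : cancel F' F).
Variable A : {pred B}.

Lemma lrmorph_mpolyC (c : k) : F c%:MP = c%:A.
Proof. by rewrite -alg_mpolyC linearZ /= rmorph1. Qed.

(** Everything is transported along F to the polynomial ring itself, where the
    retraction becomes the substitution of the polynomials h_i. *)
Theorem graded_retract_polynomial : retract A -> has_nontrivial_Zgrading A ->
    (forall u v w : {mpoly k[n]}, F u \in A -> F v \in A -> F w \in A ->
      exists2 p : {mpoly k[3]}, p != 0 &
        mmap (@mpolyC n k) (fun i => [:: u; v; w]`_i) p = 0) ->
  exists r, sub_is_poly_ring A r.
Proof.
move=> [_ [phi [phi_idem phiA]]] [G [[GA Glin GM Gspan Gind] Gnontriv]] dep.
have F_inj := can_inj FK.
pose A' : {pred {mpoly k[n]}} := [pred p | F p \in A].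
pose h := [tuple F' (phi (F 'X_i)) | i < n].
have hE p : F (p \mPo h) = phi (F p).
  elim/mpoly_alg_ind: p => [c|i|p q Ep Eq|p q Ep Eq].
  - by rewrite comp_mpolyC lrmorph_mpolyC linearZ /= rmorph1.
  - by rewrite comp_mpolyXU -tnth_nth tnth_mktuple F'K.
  - by rewrite !rmorphD /= Ep Eq.
  - by rewrite !rmorphM /= Ep Eq.
have idem p : (p \mPo h) \mPo h = p \mPo h by apply: F_inj; rewrite !hE phi_idem.
have AE p : p \in A' <-> retr h p.
  split=> [/phiA[b Fp]|rp]; first by apply: F_inj; rewrite hE Fp phi_idem.
  by apply/phiA; exists (F p); rewrite -hE rp.
have grA' : Zgrading A' (fun d p => G d (F p)).
  split.
  - by move=> d a /GA.
  - by move=> d; have [G0 GL] := Glin d; split=> [|c u v Gu Gv]; rewrite ?rmorph0 // linearP; apply: GL.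
  - by move=> d e u v Gu Gv; rewrite rmorphM; apply: GM.
  - move=> a /Gspan[s [c [us Gc def_a]]]; exists s, (F' \o c); split=> // [d|].
      by rewrite /= F'K.
    by apply: F_inj; rewrite def_a rmorph_sum; apply: eq_bigr => d _; rewrite /= F'K.
  move=> s c us Gc s0 d ds; apply: F_inj; rewrite rmorph0.
  apply: (Gind s (F \o c)) => //.
  by rewrite -[RHS](rmorph0 F) -s0 rmorph_sum.
have nontriv : ~ (forall a, G 0 (F a) <-> a \in A').
  move=> triv; apply: Gnontriv => b; have := triv (F' b).
  by rewrite inE F'K.
have dep3 u v w : retr h u -> retr h v -> retr h w ->
    exists2 Q, Q != 0 & tri u v w Q = 0.
  move=> /AE Au /AE Av /AE Aw; have [p p0 rel] := dep u v w Au Av Aw.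
  exists (nest3 k p); first by rewrite -(rmorph0 (nest3 k)) (inj_eq (@nest3_inj k)).
  by rewrite -[RHS]rel mmap_nest3.
have [r [Y [rY genY freeY]]] := graded_retract_generators idem AE dep3 grA' nontriv.
pose t : r.-tuple {mpoly k[n]} := [tuple Y i | i < r].
have tE p : p \mPo t = mmap (@mpolyC n k) Y p.
  by apply: eq_mmap => // i; rewrite tnth_mktuple.
exists r, (F \o comp_mpoly t : {lrmorphism {mpoly k[r]} -> B}); split.
  apply: raddf_inj => p /= /eqP; rewrite -[0](rmorph0 F) (inj_eq F_inj) tE => /eqP.
  exact: freeY.
move=> b; split=> [Ab|[p ->]] /=.
  have /AE/genY[p def_b] : F' b \in A' by rewrite inE F'K.
  by exists p; rewrite tE -def_b F'K.
suff /AE : retr h (p \mPo t) by [].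
rewrite tE /mmap; elim/big_rec: _ => [|m x _ rx]; first exact: retr0.
apply: retrD => //; apply: retrM; first exact: retrC.
rewrite /mmap1; elim/big_rec: _ => [|i y _ ry]; first exact: (retrC h 1).
by apply: retrM => //; apply: retrX.
Qed.

End Transfer.

(** * Transcendence degree *)

Lemma algebraic_over_self (k K : fieldType) (iota : {rmorphism k -> K}) d (t : 'I_d -> K) x :
  adjoined iota t x -> algebraic_over (adjoined iota t) x.
Proof.
case=> p [q [q0 xE]]; exists ('X - x%:P); split.
- by rewrite polyXsubC_eq0.
- have adjC (p' : {mpoly k[d]}) : adjoined iota t (mmap iota t p').
    by exists p', 1; rewrite rmorph1 oner_eq0 divr1.
  move=> i; rewrite coefB coefX coefC; case: i => [|[|i]] /=.
  + by exists (- p), q; rewrite sub0r rmorphN mulNr -xE.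
  + by have := adjC 1; rewrite rmorph1 subr0.
  by have := adjC 0; rewrite rmorph0 subr0.
- by rewrite root_XsubC.
Qed.

Section TranscendenceDegreeOfSubalgebra.

Variables (k : closedFieldType) (B : idomAlgType k) (A : {pred B}).
Let iota := (@tofrac B \o GRing.in_alg B : {rmorphism k -> {fraction B}}).

Hypothesis A1 : 1 \in A.

Lemma quotient_field_sub a : a \in A -> quotient_field A (tofrac a).
Proof. by move=> Aa; exists a, 1; rewrite oner_neq0 tofrac1 divr1. Qed.

Lemma trdeg_dependent d m (a : 'I_m -> B) : trdeg A d -> (d < m)%N ->
  (forall i, a i \in A) -> exists2 p : {mpoly k[m]}, p != 0 & mmap (GRing.in_alg B) a p = 0.
Proof.
move=> [t [_ _ alg_t]] lt_dm Aa.
have [|p p0 rel] := @trdeg_bound k {fraction B} iota d m t (fun i => tofrac (a i)) _ lt_dm.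
  by move=> i; apply/alg_t/quotient_field_sub.
exists p => //; apply/eqP; rewrite -tofrac_eq0; apply/eqP.
by rewrite rmorph_mmap.
Qed.

Lemma sub_poly_trdeg_le r d : sub_is_poly_ring A r -> trdeg A d -> (d <= r)%N.
Proof.
move=> [f [f_inj fA]] [t [At indep _]]; rewrite leqNgt; apply/negP => lt_rd.
pose y (i : 'I_r) : {fraction B} := tofrac (f 'X_i).
have evE p : mmap iota y p = tofrac (f p).
  rewrite -[in RHS](mmap_id p) rmorph_mmap rmorph_mmap; apply: eq_mmap => // c /=.
  by rewrite -alg_mpolyC linearZ /= rmorph1.
have [|p p0 /indep p0'] := @trdeg_bound k {fraction B} iota r d y t _ lt_rd.
  move=> i; apply: algebraic_over_self.
  have [a [b [/fA[p ->] /fA[q ->] q0 ->]]] := At i.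
  by exists p, q; rewrite !evE tofrac_eq0.
by rewrite p0' eqxx in p0.
Qed.

Lemma sub_poly_trdeg_ge r d : sub_is_poly_ring A r -> trdeg A d -> (r <= d)%N.
Proof.
move=> [f [f_inj fA]] trA; rewrite leqNgt; apply/negP => lt_dr.
have [|p p0 rel] := trdeg_dependent (a := fun i => f 'X_i) trA lt_dr.
  by move=> i; apply/fA; exists 'X_i.
case/negP: p0; apply/eqP/f_inj; rewrite rmorph0 -[RHS]rel -[in LHS](mmap_id p) rmorph_mmap.
by apply: eq_mmap => // c /=; rewrite -alg_mpolyC linearZ /= rmorph1.
Qed.

End TranscendenceDegreeOfSubalgebra.

Theorem theorem3p7 (k : closedFieldType) :
  (forall (n : nat) (B : idomAlgType k) (A : {pred B}),
      (2 <= n)%N ->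
      is_poly_ring B n ->
      retract A ->
      trdeg A 2 ->
      has_nontrivial_Zgrading A ->
      sub_is_poly_ring A 2) /\
  (forall A : {pred {mpoly k[3]}},
      retract A ->
      has_nontrivial_Zgrading A ->
      exists e : nat, sub_is_poly_ring A e).
Proof.
split=> [n B A _ [F [F' FK F'K]] retA trA grA|A retA grA].
  have A1 : 1 \in A by case: retA => [[]].
  have [|r polA] := graded_retract_polynomial FK F'K retA grA.
    move=> u v w Au Av Aw.
    have [|p p0 rel] := trdeg_dependent A1 (a := fun i : 'I_3 => F [:: u; v; w]`_i) trA isT.
      by case=> [[|[|[|i]]]].
    exists p => //; apply: (can_inj FK); rewrite rmorph0 -[RHS]rel rmorph_mmap.
    by apply: eq_mmap => // c; apply: lrmorph_mpolyC.
  have r2 : r = 2; last by rewrite r2 in polA.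
  apply/eqP; rewrite eqn_leq (sub_poly_trdeg_le polA trA) andbT.
  exact: (sub_poly_trdeg_ge A1 polA trA).
have [_ [phi [phi_idem phiA]]] := retA.
have [[g [g0 phig0]]|phi_inj] := classic (exists g, g != 0 /\ phi g = 0).
  apply: (@graded_retract_polynomial k 3 _ (idfun : {lrmorphism {mpoly k[3]} -> _}) id) => //.
  have fixA (b : {mpoly k[3]}) : b \in A -> phi b = b by move=> /phiA[c ->].
  move=> u v w /fixA def_u /fixA def_v /fixA def_w.
  have [p p0 rel] := kernel_dependent (fun i : 'I_3 => [:: u; v; w]`_i) g0 phig0.
  exists p => //; rewrite -[RHS]rel; apply: eq_mmap => [c|] /=.
    by rewrite (lrmorph_mpolyC phi) alg_mpolyC.
  by case=> [[|[|[|i]]]] //= _; apply/esym.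
exists 3, (idfun : {lrmorphism {mpoly k[3]} -> _}); split=> // b; split=> _; first by exists b.
apply/phiA; exists b; apply/esym/eqP; rewrite -subr_eq0; apply/negPn/negP => nz.
by apply: phi_inj; exists (phi b - b); rewrite rmorphB /= phi_idem subrr.
Qed.
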